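(* Let $F=F(s,u,v,t_1,t_2,\dots)$ be the generating function defined in the context, and define the operators $$L_1F=\sum_{i=2}^\infty (i-1)t_i\frac{\partial F}{\partial t_{i-1}},\qquad M_1F=\sum_{i=2}^\infty\sum_{j=1}^{i-1}\Big((i-1)t_jt_{i-j}\frac{\partial F}{\partial t_{i-1}}+j(i-j)t_{i+1}\frac{\partial^2F}{\partial t_j\partial t_{i-j}}\Big),$$ $$Q_1F=\sum_{i=2}^\infty\sum_{j=1}^{i-1} j(i-j)t_{i+1}\frac{\partial F}{\partial t_j}\cdot\frac{\partial F}{\partial t_{i-j}}.$$ Then $F$ satisfies $$\frac{\partial F}{\partial s}=\big((u+v)L_1+M_1+Q_1\big)F+uvt_1,$$ and $F$ is the unique formal power series solution of this equation with $F|_{s=0}=0$. Equivalently, the partition function $Z=e^F$ is given by $$Z(s,u,v,t_1,t_2,\dots)=e^{s((u+v)L_1+M_1+uvt_1)}\,1,$$ where $1$ is the constant function $1$ and $uvt_1$ acts as a multiplication operator.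
   Context: A Belyi graph is a connected graph $\Gamma$ in which every vertex is colored white or black, every edge joins a white vertex to a black vertex, and every edge is colored blue, green or red so that each vertex is incident to exactly one edge of each color. $\Gamma$ carries the ribbon graph structure given by the counterclockwise cyclic order blue–green–red at white vertices and red–green–blue at black vertices. Automorphisms of $\Gamma$ are graph automorphisms preserving the colors of vertices and edges. The degree $d$ of $\Gamma$ is its number of green edges. The type of $\Gamma$ is the triple $(k,l;\mathbf m)$, $\mathbf m=(m_1,m_2,\dots)$, where $k$ is the number of red–green cycles of $\Gamma$, $l$ is the number of green–blue cycles, and $m_i$ is the number of red–blue cycles of length $2i$ (consisting of $i$ red and $i$ blue edges); then $\sum_i im_i=d$ and the genus $g$ of the ribbon graph satisfies $2g-2=d-(k+l+\sum_im_i)$. (Equivalently, for the corresponding Belyi pair $(C,f)$: $k=|f^{-1}(0)|$, $l=|f^{-1}(1)|$, $m_i$ is the number of poles of $f$ of order $i$.) Let $\mathcal B_{k,l;\mathbf m}$ be the set of isomorphism classes of Belyi graphs of type $(k,l;\mathbf m)$ and $$\mathcal N_{k,l}(\mathbf m)=\sum_{\Gamma\in\mathcal B_{k,l;\mathbf m}}\frac{1}{|\mathrm{Aut}(\Gamma)|}.$$ The generating function is the formal power series $$F(s,u,v,t_1,t_2,\dots)=\sum_{d\ge1}s^d\sum_{k,l\ge1}\ \sum_{\mathbf m:\ \sum_i im_i=d}\mathcal N_{k,l}(\mathbf m)\,u^kv^l\,t_1^{m_1}t_2^{m_2}\cdots.$$ *)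

(* Defs.v *)
From HB Require Import structures.
From mathcomp Require Import all_boot all_order all_algebra all_fingroup.
Set Implicit Arguments. Unset Strict Implicit. Unset Printing Implicit Defensive.
Import Order.TTheory GRing.Theory Num.Theory.

(* Formal power series in s, u, v, t_1, t_2, ... with rational coefficients. *)
(* A series G is its coefficient function: G d k l m is the coefficient of   *)
(*   s^d u^k v^l t_1^(m_1) t_2^(m_2) ...,  where m = [:: m_1; m_2; ...].      *)
(* Exponent sequences are compared up to trailing zeros: coefficients are    *)
(* always read through [coef], which first normalises m by [trim].           *)

Definition PS := nat -> nat -> nat -> seq nat -> rat.

Fixpoint trim (m : seq nat) : seq nat :=
  match m with
  | [::] => [::]
  | x :: m' => let t := trim m' in if (x == 0%N) && (t == [::]) then [::] else x :: t
  end.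

Definition coef (G : PS) d k l (m : seq nat) : rat := G d k l (trim m).

Definition texp (m : seq nat) (i : nat) : nat := nth 0%N m i.-1.

Local Open Scope ring_scope.

Definition ps_add (G H : PS) : PS := fun d k l m => coef G d k l m + coef H d k l m.

Definition ps_one : PS :=
  fun d k l m => if [&& d == 0%N, k == 0%N, l == 0%N & trim m == [::]] then 1 else 0.

Definition ps_uvt1 : PS :=
  fun d k l m => if [&& d == 0%N, k == 1%N, l == 1%N & trim m == [:: 1%N]] then 1 else 0.

Definition ps_mulu (G : PS) : PS :=
  fun d k l m => if k is k'.+1 then coef G d k' l m else 0.
Definition ps_mulv (G : PS) : PS :=
  fun d k l m => if l is l'.+1 then coef G d k l' m else 0.
Definition ps_mult (i : nat) (G : PS) : PS :=
  fun d k l m => if (0 < texp m i)%N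
                 then coef G d k l (set_nth 0%N m i.-1 (texp m i).-1) else 0.

Definition ps_ds (G : PS) : PS := fun d k l m => d.+1%:R * coef G d.+1 k l m.
Definition ps_dt (j : nat) (G : PS) : PS :=
  fun d k l m => (texp m j).+1%:R * coef G d k l (incr_nth m j.-1).

Fixpoint subvecs (m : seq nat) : seq (seq nat) :=
  match m with
  | [::] => [:: [::]]
  | x :: m' => [seq a :: s | a <- iota 0 x.+1, s <- subvecs m']
  end.

Definition vsub (m a : seq nat) : seq nat := [seq (p.1 - p.2)%N | p <- zip m a].

Definition ps_mul (G H : PS) : PS :=
  fun d k l m =>
    \sum_(d1 < d.+1) \sum_(k1 < k.+1) \sum_(l1 < l.+1) \sum_(a <- subvecs m)
       coef G d1 k1 l1 a * coef H (d - d1)%N (k - k1)%N (l - l1)%N (vsub m a).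

Definition ps_pow (G : PS) (n : nat) : PS := iter n (ps_mul G) ps_one.

(* Truncation bound for the sums over i in L_1, M_1, Q_1: every term with   *)
(* i >= bnd m contains a factor t_a with a > size m, so its coefficient at  *)
(* the monomial with t-exponents m is 0; the truncated sum is exact.        *)
Definition bnd (m : seq nat) : nat := ((size m).*2 + 3)%N.

Definition L1 (G : PS) : PS :=
  fun d k l m => \sum_(2 <= i < bnd m)
     (i.-1)%:R * coef (ps_mult i (ps_dt i.-1 G)) d k l m.

Definition M1 (G : PS) : PS :=
  fun d k l m => \sum_(2 <= i < bnd m) \sum_(1 <= j < i)
     ((i.-1)%:R * coef (ps_mult j (ps_mult (i - j) (ps_dt i.-1 G))) d k l m
      + (j * (i - j))%:R * coef (ps_mult i.+1 (ps_dt j (ps_dt (i - j) G))) d k l m).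

Definition Q1 (G : PS) : PS :=
  fun d k l m => \sum_(2 <= i < bnd m) \sum_(1 <= j < i)
     (j * (i - j))%:R * coef (ps_mult i.+1 (ps_mul (ps_dt j G) (ps_dt (i - j) G))) d k l m.

Definition rhs (G : PS) : PS :=
  ps_add (ps_add (ps_add (ps_mulu (L1 G)) (ps_mulv (L1 G))) (ps_add (M1 G) (Q1 G))) ps_uvt1.

Definition Aop (G : PS) : PS :=
  ps_add (ps_add (ps_mulu (L1 G)) (ps_mulv (L1 G))) (ps_add (M1 G) (ps_mul ps_uvt1 G)).

Definition expsA1 : PS :=
  fun d k l m => \sum_(n < d.+1) coef (iter n Aop ps_one) (d - n)%N k l m / (n`!)%:R.

(* e^G = sum_n G^n/n!, for G without s^0 term (then G^n has s-order >= n,  *)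
(* so only n <= d contributes to the coefficient of s^d).                   *)
Definition ps_exp (G : PS) : PS :=
  fun d k l m => \sum_(n < d.+1) coef (ps_pow G n) d k l m / (n`!)%:R.

(* Belyi graphs.  A Belyi graph of degree d has d white and d black         *)
(* vertices (one green edge at each vertex); we take white vertices 'I_d    *)
(* and black vertices 'I_d.  Since each vertex meets exactly one edge of     *)
(* each colour, the edges of a colour form a perfect matching, i.e. a       *)
(* bijection white -> black.  A Belyi graph is thus a triple (b, g, r) of   *)
(* permutations: the blue (resp. green, red) edge at white w goes to black  *)
(* b w (resp. g w, r w).                                                    *)

Definition btriple (d : nat) := ('S_d * 'S_d * 'S_d)%type.

Definition bblue d (G : btriple d) : 'S_d := G.1.1.
Definition bgreen d (G : btriple d) : 'S_d := G.1.2.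
Definition bred d (G : btriple d) : 'S_d := G.2.

Definition badj d (cols : seq 'S_d) : rel ('I_d + 'I_d) :=
  fun x y => match x, y with
             | inl w, inr v => has (fun p : 'S_d => p w == v) cols
             | inr v, inl w => has (fun p : 'S_d => p w == v) cols
             | _, _ => false
             end.

Definition bconnected d (G : btriple d) : bool :=
  [forall x, forall y, connect (badj [:: bblue G; bgreen G; bred G]) x y].

(* number of red-green cycles (components of the red-green subgraph) *)
Definition bk d (G : btriple d) : nat := n_comp (badj [:: bred G; bgreen G]) predT.
Definition bl d (G : btriple d) : nat := n_comp (badj [:: bgreen G; bblue G]) predT.
Definition bm d (G : btriple d) (i : nat) : nat :=
  #|[pred x | roots (badj [:: bred G; bblue G]) x &&
              (#|[pred y | connect (badj [:: bred G; bblue G]) x y]| == i.*2)]|.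
Definition bmseq d (G : btriple d) : seq nat := [seq bm G i | i <- iota 1 d].

Definition has_type d (G : btriple d) (k l : nat) (m : seq nat) : bool :=
  [&& bk G == k, bl G == l & trim (bmseq G) == trim m].

(* relabelling of white vertices by p.1 and black vertices by p.2:  the      *)
(* isomorphic graph with matchings  x' = p.2 o x o p.1^-1                    *)
Definition relabel d (p : 'S_d * 'S_d) (G : btriple d) : btriple d :=
  ((p.1^-1 * bblue G * p.2, p.1^-1 * bgreen G * p.2)%g, (p.1^-1 * bred G * p.2)%g).

Definition bAut d (G : btriple d) : {set 'S_d * 'S_d} := [set p | relabel p G == G].

Definition bclasses d (k l : nat) (m : seq nat) : {set {set btriple d}} :=
  [set [set relabel p G | p : 'S_d * 'S_d] | G in [set G : btriple d | bconnected G && has_type G k l m]].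

Definition brep d (C : {set btriple d}) : btriple d := odflt ((1, 1), 1)%g [pick G in C].

Definition Ncount d (k l : nat) (m : seq nat) : rat :=
  \sum_(C in bclasses d k l m) 1 / (#|bAut (brep C)|)%:R.

Definition weight (m : seq nat) : nat := \sum_(i < size m) (i.+1 * nth 0%N m i)%N.

Definition Fser : PS :=
  fun d k l m => if [&& (0 < d)%N, (0 < k)%N, (0 < l)%N & weight m == d]
                 then Ncount d k l m else 0.

(* Main.v *)
(* Contracting all green edges turns a Belyi graph into a pair (rho, beta) of permutations of
   the white vertices, whose cycles, together with those of rho beta^-1, are the three kinds
   of bicoloured cycles; N counts transitive pairs divided by d!. Let Z count all pairs.
   - A pair on n+1 points is obtained from a pair on n points by inserting the last point
     after some x in rho and some y in beta (or as a fixed point); rho beta^-1 is then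
     multiplied by two transpositions, which cut or join its cycles. This gives the linear
     equation dZ/ds = ((u+v) L_1 + M_1 + u v t_1) Z.
   - Splitting off the orbit of the last point gives dZ/ds = Z dF/ds, that is, Z = e^F.
   As L_1 and the first-order part of M_1 are derivations, while the second-order part of M_1
   applied to e^F produces the extra term e^F Q_1 F, dividing the linear equation by e^F
   yields the equation for F. All series are compared with polynomials in finitely many
   variables, modulo powers of s. *)

(* Removing a point from a transitive pair can leave two components, and this is what the quadratic
   term Q_1 records. The recursion is therefore proved for all pairs, where it is linear, and
   connectedness enters only through the exponential formula. The factors (i - 1) and j (i - j) of
   the operators count the points at which a cycle, or an ordered pair of cycles, is cut or joined;
   they appear when sums over points are rewritten as sums over cycles. In a polynomial ring e^F
   exists only up to a power of s, whence the truncated exponential and the congruences modulo s^D.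
   Derivatives by t_j preserve such congruences, while the derivative by s loses a power, so the
   argument never differentiates a congruence by s. Uniqueness rests on a different remark: the
   coefficient of s^d on the right-hand side depends only on coefficients of G up to s^d, so the
   equation is a recursion on the order in s. *)
Require Import Defs.
From HB Require Import structures.
From mathcomp Require Import all_boot all_order all_algebra all_fingroup.
From mathcomp Require Import zify ring mpoly.
Set Implicit Arguments. Unset Strict Implicit. Unset Printing Implicit Defensive.
Import Order.TTheory GRing.Theory Num.Theory.

(** * Cycles of a permutation times a transposition *)

Lemma porbit_morph (T1 T : finType) (h : T1 -> T) (s1 : {perm T1}) (s : {perm T}) :
  (forall x, s (h x) = h (s1 x)) ->
  forall x, porbit s (h x) = h @: porbit s1 x.
Proof.
move=> hs x; have hX i y : (s ^+ i)%g (h y) = h ((s1 ^+ i)%g y).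
  by elim: i => [|i IHi]; rewrite ?expg0 ?perm1 // !expgSr !permM IHi hs.
apply/setP=> y; apply/porbitP/imsetP => [[i ->]|[z /porbitP[i ->] ->]].
  by exists ((s1 ^+ i)%g x); rewrite ?hX ?mem_porbit.
by exists i; rewrite hX.
Qed.

Lemma porbit_perm1 (T : finType) (s : {perm T}) x : porbit s (s x) = porbit s x.
Proof. by have := porbit_perm s 1 x; rewrite expg1. Qed.

Section TpermPorbit.
Variables (T : finType) (s : {perm T}).
Implicit Types x y z : T.

Lemma porbit_tperm_other x y z :
  z \notin porbit s x -> z \notin porbit s y ->
  porbit (tperm x y * s)%g z = porbit s z.
Proof.
move=> zx zy; have sX i : ((tperm x y * s) ^+ i)%g z = (s ^+ i)%g z.
  elim: i => [|i IHi]; rewrite ?expg0 // !expgSr !permM IHi.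
  rewrite tpermD //.
    by apply: contraNneq zx => ->; rewrite porbit_sym mem_porbit.
  by apply: contraNneq zy => ->; rewrite porbit_sym mem_porbit.
by apply/setP=> w; apply/porbitP/porbitP => -[i ->]; exists i; rewrite sX.
Qed.

(** Products of permutations act from left to right, so [s'] sends x to [s y]. From there it follows
    the cycle of y under [s], which avoids x and returns to y only when it is complete. *)
Lemma porbit_tperm_sub x y :
  y \notin porbit s x -> porbit s y \subset porbit (tperm x y * s)%g x.
Proof.
move=> yx; set s' := (tperm x y * s)%g.
have s'x : s y = s' x by rewrite permM tpermL.
have step i : (s ^+ i.+1)%g y \in porbit s' x.
  elim: i => [|i IHi]; first by rewrite expg1 s'x -(porbit_perm1 s' x) porbit_id.
  rewrite expgSr permM; set w := (s ^+ i.+1)%g y in IHi *.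
  have [->|wy] := eqVneq w y; first by rewrite s'x -(porbit_perm1 s' x) porbit_id.
  suff -> : s w = s' w by rewrite -eq_porbit_mem porbit_perm1 eq_porbit_mem.
  rewrite permM tpermD // eq_sym //; apply: contraNneq yx => <-.
  by rewrite porbit_sym mem_porbit.
apply/subsetP=> z /porbitP[[|i] ->] //.
(* The point y itself is also reached by a positive power of [s], namely the length of its cycle. *)
have := iter_porbit s y; rewrite expg0 perm1.
have := card_porbit_neq0 s y; case: #|_| => [//|n _].
by rewrite -permX => e; move: (step n); rewrite e.
Qed.

Lemma porbit_tperm_merge x y : y \notin porbit s x ->
  porbit (tperm x y * s)%g x = porbit s x :|: porbit s y.
Proof.
move=> yx; set s' := (tperm x y * s)%g.
have sub1 : porbit s y \subset porbit s' x by apply: porbit_tperm_sub.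
have e : porbit s' y = porbit s' x.
  by apply/eqP; rewrite eq_porbit_mem (subsetP sub1) ?porbit_id.
have sub2 : porbit s x \subset porbit s' x.
  by rewrite -e /s' tpermC; apply: porbit_tperm_sub; rewrite porbit_sym.
apply/eqP; rewrite eqEsubset subUset sub1 sub2 !andbT.
apply/subsetP=> z /porbitP[i ->]; elim: i => [|i].
  by rewrite expg0 perm1 inE porbit_id.
rewrite expgSr permM; set w := (s' ^+ i)%g x; rewrite permM !inE.
by case: tpermP => [_ _|_ _|_ _];
  rewrite -!eq_porbit_mem !porbit_perm1 !eq_porbit_mem ?porbit_id ?orbT.
Qed.

Lemma porbits_tperm_merge x y : y \notin porbit s x ->
  porbits (tperm x y * s)%g
    = (porbit s x :|: porbit s y) |: (porbits s :\ porbit s x :\ porbit s y).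
Proof.
move=> yx; set s' := (tperm x y * s)%g.
have ex := porbit_tperm_merge yx; rewrite -/s' in ex.
have ey : porbit s' y = porbit s' x.
  by apply/eqP; rewrite eq_porbit_mem ex inE porbit_id orbT.
have oth z : z \notin porbit s x -> z \notin porbit s y -> porbit s' z = porbit s z
  := @porbit_tperm_other x y z.
have ne z : (porbit s z != porbit s x) = (z \notin porbit s x) by rewrite eq_porbit_mem.
apply/setP=> C; rewrite !inE; apply/imsetP/orP => [[z _ ->]|].
  have [/orP zU|] := boolP ((z \in porbit s x) || (z \in porbit s y)).
    left; rewrite -ex eq_porbit_mem ex inE; exact/orP.
  rewrite negb_or => /andP[zx zy]; right.
  by rewrite oth // !eq_porbit_mem zx zy imset_f.
case=> [/eqP->|/and3P[Cy Cx /imsetP[z _ defC]]]; first by exists x.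
by exists z => //; rewrite oth // -?eq_porbit_mem -?defC // eq_sym.
Qed.

End TpermPorbit.

Section TpermSplit.
Variables (T : finType) (s : {perm T}).
Implicit Types x y z : T.

(** By counting cycles: if x and y still shared a cycle, each of two multiplications by the same
    transposition would add one cycle, although together they cancel. *)
Lemma porbit_tperm_split x y : y \in porbit s x -> x != y ->
  y \notin porbit (tperm x y * s)%g x.
Proof.
move=> yx xy; set s' := (tperm x y * s)%g.
apply/negP=> yx'.
have /= e1 := porbits_mul_tperm s x y.
have /= e2 := porbits_mul_tperm s' x y.
rewrite -/s' porbit_sym yx xy /= addn0 addn1 in e1.
rewrite mulgA tperm2 mul1g porbit_sym yx' /= xy addn0 e1 in e2.
by move: e2; clear; lia.
Qed.

(** As [s] is in turn [tperm x y * s'], this is the merging lemma for [s'] read backwards. *)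
Lemma porbits_tperm_split x y : y \in porbit s x -> x != y ->
  let s' := (tperm x y * s)%g in
  [/\ porbit s x = porbit s' x :|: porbit s' y,
      porbits s' = porbit s' x |: (porbit s' y |: (porbits s :\ porbit s x)),
      porbit s' x \notin porbit s' y |: (porbits s :\ porbit s x) &
      porbit s' y \notin porbits s :\ porbit s x].
Proof.
move=> yx xy s'.
have nyx : y \notin porbit s' x by apply: porbit_tperm_split.
have es : s = (tperm x y * s')%g by rewrite mulgA tperm2 mul1g.
have ex : porbit s x = porbit s' x :|: porbit s' y.
  by have := porbit_tperm_merge nyx; rewrite -es.
have D : porbits s :\ porbit s x = porbits s' :\ porbit s' x :\ porbit s' y.
  have := porbits_tperm_merge nyx; rewrite -es ex => ->; rewrite setU1K //.
  rewrite !inE !negb_and !negbK; apply/orP; right; apply/orP; right.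
  apply/imsetP=> -[z _ ez].
  have: x \in porbit s' z by rewrite -ez inE porbit_id.
  have: y \in porbit s' z by rewrite -ez inE porbit_id orbT.
  rewrite -!eq_porbit_mem => /eqP e1 /eqP e2.
  by move: nyx; rewrite -eq_porbit_mem e1 e2 eqxx.
have neq : (porbit s' x == porbit s' y) = false.
  by rewrite eq_porbit_mem porbit_sym; apply: negbTE.
rewrite D; split=> //; last by rewrite !inE eqxx.
  rewrite setD1K ?setD1K ?imset_f // !inE imset_f // andbT eq_sym neq //.
by rewrite !inE neq eqxx andbF.
Qed.

Lemma eq_iter_porbit z i j : i < #|porbit s z| -> j < #|porbit s z| ->
  (iter i s z == iter j s z) = (i == j).
Proof.
move=> li lj; rewrite -(nth_uniq z _ _ (uniq_traject_porbit s z)) ?size_traject //.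
by rewrite !nth_traject.
Qed.

(* Cutting the cycle of z between z and s^k z leaves s z, ..., s^k z as a cycle. *)
Lemma card_porbit_tperm_split z k : 0 < k < #|porbit s z| ->
  #|porbit (tperm z (iter k s z) * s)%g (iter k s z)| = k.
Proof.
case: k => [//|k] /= kn; set x := s (iter k s z); set s' := (tperm z x * s)%g.
have iE i : i <= k -> iter i s' (s z) = iter i.+1 s z.
  elim: i => [//|i IHi] ik; rewrite iterS IHi ?(ltnW ik) // permM tpermD //.
    have : iter 0 s z != iter i.+1 s z by rewrite eq_iter_porbit // ltnW // (leq_trans _ kn).
    by [].
  have : iter k.+1 s z != iter i.+1 s z by rewrite eq_iter_porbit // ?gtn_eqF // (leq_trans _
    kn) // ltnW.
  by [].
have s'x : s' x = s z by rewrite permM tpermR.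
have tE : traject s' (s z) k.+1 = traject s (s z) k.+1.
  apply: (@eq_from_nth _ (s z)) => [|i]; rewrite !size_traject // => ik.
  by rewrite !nth_traject // iE // iterSr.
have sub i : (s' ^+ i)%g (s z) \in traject s' (s z) k.+1.
  elim: i => [|i]; first by rewrite expg0 perm1 mem_head.
  rewrite expgSr permM => /trajectP[j jk ->].
  have [->|jk'] := eqVneq j k; first by rewrite iE // -/x s'x mem_head.
  apply/trajectP; exists j.+1; last by rewrite iterS.
  by rewrite ltn_neqAle eqSS jk' jk.
have xE : x = iter k s' (s z) by rewrite iE.
rewrite xE -permX porbit_perm.
transitivity #|traject s' (s z) k.+1|.
  apply: eq_card => w; apply/porbitP/idP => [[i ->] //|/trajectP[i _ ->]].
  by exists i; rewrite permX.
rewrite (card_uniqP _) ?size_traject // tE -(rotr_uniq 1).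
have := uniq_traject_porbit s z; have [n ->] : exists n, #|porbit s z| = k.+2 + n.
  by exists (#|porbit s z| - k.+2); rewrite subnKC.
rewrite trajectD cat_uniq rotr_uniq => /andP[utr _].
by move: utr; rewrite trajectS cons_uniq => /andP[].
Qed.

(** The points other than z on its cycle are the [iter j s z] for 0 < j below the length, and
    cutting at such a point leaves it on a cycle of length j. Hence each j occurs once. *)
Lemma sum_porbit_split (R : nmodType) (g : nat -> R) z :
  (\sum_(x in porbit s z | x != z) g #|porbit (tperm x z * s)%g x|
    = \sum_(1 <= j < #|porbit s z|) g j)%R.
Proof.
rewrite big_mkcondr /=; rewrite (eq_bigl (mem (traject s z #|porbit s z|)));
  last exact: porbit_traject.
rewrite -big_uniq ?uniq_traject_porbit //= -big_mkcond /=.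
have ei0 := @eq_iter_porbit z; have := @card_porbit_tperm_split z; move: ei0;
  have := card_porbit_neq0 s z.
case: #|porbit s z| => [//|n] _ ei cs.
rewrite trajectS big_cons eqxx /=.
have -> : traject s (s z) n = [seq iter i s z | i <- iota 1 n].
  apply: (@eq_from_nth _ (s z)) => [|i]; rewrite size_traject ?size_map ?size_iota // => ik.
  by rewrite nth_traject // (nth_map 0) ?size_iota // nth_iota // -iterSr.
rewrite big_map /index_iota subSS subn0 big_seq_cond [RHS]big_seq_cond.
apply: eq_big => [i|i]; rewrite mem_iota add1n ltnS.
  by case/boolP: (0 < i <= n) => //= /andP[i0 ik];
    rewrite -[z in _ != z]/(iter 0 s z) ei // gtn_eqF.
by case/andP=> ik _; rewrite tpermC cs.
Qed.
End TpermSplit.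

(** * Cycle weights *)

Section CycleWeight.
Variables (R : comNzRingType) (f : nat -> R).
Local Open Scope ring_scope.

Definition blocks_weight (T : finType) (X : {set {set T}}) : R := \prod_(C in X) f #|C|.

Definition cycle_weight (T : finType) (s : {perm T}) : R := blocks_weight (porbits s).

Lemma blocks_weightU1 (T : finType) (C : {set T}) (X : {set {set T}}) :
  C \notin X -> blocks_weight (C |: X) = f #|C| * blocks_weight X.
Proof. exact: big_setU1. Qed.

Lemma blocks_weightD1 (T : finType) (C : {set T}) (X : {set {set T}}) :
  C \in X -> blocks_weight X = f #|C| * blocks_weight (X :\ C).
Proof. by move=> CX; rewrite -blocks_weightU1 ?setD1K // !inE eqxx. Qed.

Lemma blocks_weight_imset (T1 T : finType) (h : T1 -> T) (X : {set {set T1}}) :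
  injective h -> blocks_weight [set h @: C | C : {set T1} in X] = blocks_weight X.
Proof.
move=> hI; rewrite /blocks_weight big_imset /=; last by move=> C D _ _; apply: imset_inj.
by apply: eq_bigr => C _; rewrite card_imset.
Qed.

Lemma porbits_union (T1 T2 T : finType) (h1 : T1 -> T) (h2 : T2 -> T)
    (s1 : {perm T1}) (s2 : {perm T2}) (s : {perm T}) :
  (forall z, (exists x, z = h1 x) \/ (exists x, z = h2 x)) ->
  (forall x, s (h1 x) = h1 (s1 x)) -> (forall x, s (h2 x) = h2 (s2 x)) ->
  porbits s = [set h1 @: C | C : {set T1} in porbits s1]
              :|: [set h2 @: C | C : {set T2} in porbits s2].
Proof.
move=> hc hs1 hs2; apply/setP=> C; rewrite inE; apply/imsetP/orP.
  case=> z _ ->; case: (hc z) => -[x ->].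
    by left; rewrite (porbit_morph hs1) imset_f // imset_f.
  by right; rewrite (porbit_morph hs2) imset_f // imset_f.
case=> /imsetP[_ /imsetP[x _ ->] ->]; first by exists (h1 x); rewrite ?(porbit_morph hs1).
by exists (h2 x); rewrite ?(porbit_morph hs2).
Qed.

Lemma cycle_weight_union (T1 T2 T : finType) (h1 : T1 -> T) (h2 : T2 -> T)
    (s1 : {perm T1}) (s2 : {perm T2}) (s : {perm T}) :
  injective h1 -> injective h2 -> (forall x y, h1 x != h2 y) ->
  (forall z, (exists x, z = h1 x) \/ (exists x, z = h2 x)) ->
  (forall x, s (h1 x) = h1 (s1 x)) -> (forall x, s (h2 x) = h2 (s2 x)) ->
  cycle_weight s = cycle_weight s1 * cycle_weight s2.
Proof.
move=> h1I h2I hd hc hs1 hs2; rewrite /cycle_weight (porbits_union hc hs1 hs2).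
rewrite -(blocks_weight_imset (porbits s1) h1I) -(blocks_weight_imset (porbits s2) h2I).
rewrite /blocks_weight -bigU.
  by apply: eq_bigl => C; rewrite !inE.
rewrite disjoints_subset; apply/subsetP=> _ /imsetP[C /imsetP[x _ ->] ->].
rewrite inE; apply/imsetP=> -[_ /imsetP[y _ ->] e].
have: h1 x \in h2 @: porbit s2 y by rewrite -e imset_f ?porbit_id.
by case/imsetP=> z _ /eqP; rewrite (negbTE (hd _ _)).
Qed.

Lemma cycle_weight_conj (T1 T : finType) (h : T1 -> T) (s1 : {perm T1}) (s : {perm T}) :
  bijective h -> (forall x, s (h x) = h (s1 x)) -> cycle_weight s = cycle_weight s1.
Proof.
move=> hB hs; have hI := bij_inj hB; case: hB => g hg gh.
have w0 : cycle_weight (1%g : {perm void}) = 1.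
  by apply: big1 => C /imsetP[[]].
(* Conjugation is treated as a disjoint union with the empty type. *)
rewrite (@cycle_weight_union _ _ _ h (of_void T) s1 1%g s) ?w0 ?mulr1 //; try by case.
by move=> z; left; exists (g z); rewrite gh.
Qed.

Lemma cycle_weightM (T : finType) (p q : {perm T}) :
  cycle_weight (p * q)%g = cycle_weight (q * p)%g.
Proof.
apply: (@cycle_weight_conj _ _ (p^-1)%g); last by move=> x; rewrite !permM permKV permK.
by apply: injF_bij; apply: perm_inj.
Qed.

Lemma cycle_weight_merge (T : finType) (s : {perm T}) x y : y \notin porbit s x ->
  cycle_weight (tperm x y * s)%g
    = f (#|porbit s x| + #|porbit s y|) * blocks_weight (porbits s :\ porbit s x :\ porbit s y).
Proof.
move=> yx; rewrite /cycle_weight porbits_tperm_merge // blocks_weightU1.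
  rewrite cardsU disjoint_setI0 ?cards0 ?subn0 //.
  rewrite disjoints_subset; apply/subsetP=> z; rewrite inE -!eq_porbit_mem => /eqP->.
  by rewrite eq_porbit_mem porbit_sym.
rewrite !inE !negb_and !negbK; apply/orP; right; apply/orP; right.
apply/imsetP=> -[z _ ez].
have: x \in porbit s z by rewrite -ez inE porbit_id.
have: y \in porbit s z by rewrite -ez inE porbit_id orbT.
rewrite -!eq_porbit_mem => /eqP e1 /eqP e2.
by move: yx; rewrite -eq_porbit_mem e1 e2 eqxx.
Qed.

(** Only the cycle of z is affected: its pieces have complementary lengths, and all other blocks
    form a common factor. *)
Lemma sum_cycle_weight_split (T : finType) (s : {perm T}) z :
  \sum_(x in porbit s z | x != z) cycle_weight (tperm x z * s)%g
    = \sum_(1 <= j < #|porbit s z|)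
         f j * f (#|porbit s z| - j) * blocks_weight (porbits s :\ porbit s z).
Proof.
rewrite -(sum_porbit_split s (fun j => f j * f (#|porbit s z| - j) * _)).
apply: eq_bigr => x /andP[xz nxz].
have [e1 e2 e3 e4] := porbits_tperm_split (etrans (porbit_sym _ _ _) xz) nxz.
rewrite /cycle_weight e2 blocks_weightU1 // blocks_weightU1 // mulrA.
have exz : porbit s x = porbit s z by apply/eqP; rewrite eq_porbit_mem.
rewrite -exz; congr (_ * f _ * _).
have nzx := porbit_tperm_split (etrans (porbit_sym _ _ _) xz) nxz.
rewrite e1 cardsU disjoint_setI0 ?cards0 ?subn0 ?addKn //.
rewrite disjoints_subset; apply/subsetP=> w; rewrite inE -!eq_porbit_mem => /eqP->.
by rewrite eq_porbit_mem porbit_sym.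
Qed.

Lemma imsetD1_inj (T1 T : finType) (g : T1 -> T) (X : {set T1}) C :
  injective g -> (g @: X) :\ g C = g @: (X :\ C).
Proof.
move=> gI; apply/setP=> z; rewrite !inE; apply/andP/imsetP => [[zC /imsetP[x xX e]]|[x]].
  by exists x => //; rewrite !inE xX andbT -(inj_eq gI) -e.
by rewrite !inE => /andP[xC xX] ->; rewrite (inj_eq gI) xC imset_f.
Qed.

Lemma setD1C (T : finType) (X : {set T}) a b : X :\ a :\ b = X :\ b :\ a.
Proof. by rewrite !setDDl setUC. Qed.

(** * Effect of a new last point on the cycle weight *)

Section Insert.
Variables (n : nat) (sigma : 'S_n).
Let pt : 'I_n.+1 := ord_max.
Let h : 'I_n -> 'I_n.+1 := lift pt.
Let sigma' : 'S_n.+1 := lift_perm pt pt sigma.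

Let hI : injective h. Proof. exact: lift_inj. Qed.
Let hX : injective (fun C : {set 'I_n} => h @: C). Proof. exact: imset_inj. Qed.
Let sigma'h x : sigma' (h x) = h (sigma x). Proof. exact: lift_perm_lift. Qed.
Let hpt x : h x != pt. Proof. by rewrite eq_sym neq_lift. Qed.

Let porbit_h x : porbit sigma' (h x) = h @: porbit sigma x.
Proof. exact: porbit_morph. Qed.

Let pt_notin (C : {set 'I_n}) : pt \notin h @: C.
Proof. by apply/imsetP=> -[x _ /eqP]; rewrite eq_sym (negbTE (hpt x)). Qed.

Let porbit_pt : porbit sigma' pt = [set pt].
Proof.
apply/setP=> x; rewrite inE porbit_sym; case: (unliftP pt x) => [y|] ->.
  by rewrite porbit_h (negbTE (pt_notin _)) (negbTE (hpt y)).
by rewrite porbit_id eqxx.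
Qed.

Let porbits_sigma' :
  porbits sigma' = [set pt] |: [set h @: C | C : {set 'I_n} in porbits sigma].
Proof.
apply/setP=> C; rewrite !inE; apply/imsetP/orP => [[z _ ->]|].
  case: (unliftP pt z) => [y|] ->; first by right; rewrite porbit_h !imset_f.
  by left; rewrite porbit_pt.
case=> [/eqP->|/imsetP[_ /imsetP[x _ ->] ->]]; first by exists pt; rewrite ?porbit_pt.
by exists (h x); rewrite ?porbit_h.
Qed.

Let set1pt_notin (X : {set {set 'I_n}}) : [set pt] \notin [set h @: C | C : {set 'I_n} in X].
Proof.
apply/imsetP=> -[C _ e]; have := pt_notin C.
by rewrite -e inE eqxx.
Qed.

Lemma cycle_weight_lift : cycle_weight sigma' = f 1 * cycle_weight sigma.
Proof.
rewrite /cycle_weight porbits_sigma' blocks_weightU1 ?set1pt_notin //.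
by rewrite cards1 blocks_weight_imset.
Qed.

Let rest x := blocks_weight (porbits sigma :\ porbit sigma x).

Let pt_ninh y : pt \notin porbit sigma' (h y). Proof. by rewrite porbit_h. Qed.

Let porbits_insert y : porbits (tperm (h y) pt * sigma')%g
  = (h @: porbit sigma y :|: [set pt])
     |: [set h @: C | C : {set 'I_n} in porbits sigma :\ porbit sigma y].
Proof.
rewrite porbits_tperm_merge ?pt_ninh // porbit_pt porbit_h porbits_sigma'.
by rewrite setD1C setU1K ?set1pt_notin // imsetD1_inj.
Qed.

Let merged_notin y (X : {set {set 'I_n}}) :
  (h @: porbit sigma y :|: [set pt]) \notin [set h @: C | C : {set 'I_n} in X].
Proof.
apply/imsetP=> -[C _ e]; have := pt_notin C.
by rewrite -e !inE eqxx orbT.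
Qed.

Let card_merged y : #|h @: porbit sigma y :|: [set pt]| = #|porbit sigma y|.+1.
Proof. by rewrite setUC cardsU1 pt_notin card_imset. Qed.

(** The new point is a fixed point of [sigma'], and the transposition merges it into the cycle of
    y. *)
Lemma cycle_weight_insert1 y :
  cycle_weight (tperm (h y) pt * sigma')%g = f #|porbit sigma y|.+1 * rest y.
Proof.
by rewrite /cycle_weight porbits_insert blocks_weightU1 // card_merged blocks_weight_imset.
Qed.

(** After the first transposition the new point lies on the cycle of y, so the second one joins the
    cycle of x to it; the successor counts the new point. *)
Lemma cycle_weight_insert2 x y : x \notin porbit sigma y ->
  cycle_weight (tperm (h x) pt * (tperm (h y) pt * sigma'))%g
   = f (#|porbit sigma x| + #|porbit sigma y|).+1
     * blocks_weight (porbits sigma :\ porbit sigma y :\ porbit sigma x).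
Proof.
move=> xy; set s1 := (tperm (h y) pt * sigma')%g.
have e1 : porbit s1 (h x) = h @: porbit sigma x.
  rewrite -porbit_h; apply: porbit_tperm_other; last by rewrite porbit_pt inE.
  by rewrite porbit_h mem_imset.
have e2 : porbit s1 pt = h @: porbit sigma y :|: [set pt].
  rewrite -porbit_h -porbit_pt -porbit_tperm_merge // -/s1.
  by apply/eqP; rewrite eq_porbit_mem porbit_tperm_merge // inE porbit_id orbT.
rewrite cycle_weight_merge e1 ?pt_notin // e2 card_merged card_imset // addnS.
congr (_ * _); rewrite porbits_insert.
by rewrite setD1C setU1K // imsetD1_inj // blocks_weight_imset.
Qed.

(** Here x lies on the cycle that has just received the new point, so the second transposition cuts
    this lengthened cycle between x and the new point. *)
Lemma sum_cycle_weight_insert2 y :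
  \sum_(x in porbit sigma y) cycle_weight (tperm (h x) pt * (tperm (h y) pt * sigma'))%g
   = \sum_(1 <= j < #|porbit sigma y|.+1) f j * f (#|porbit sigma y|.+1 - j) * rest y.
Proof.
set s1 := (tperm (h y) pt * sigma')%g.
have e2 : porbit s1 pt = h @: porbit sigma y :|: [set pt].
  rewrite -porbit_h -porbit_pt -porbit_tperm_merge // -/s1.
  by apply/eqP; rewrite eq_porbit_mem porbit_tperm_merge // inE porbit_id orbT.
have := sum_cycle_weight_split s1 pt; rewrite e2 card_merged porbits_insert setU1K //.
rewrite blocks_weight_imset // => <-.
rewrite -(big_imset (fun z => cycle_weight (tperm z pt * s1)%g) (in2W hI)) /=.
apply: eq_bigl => z; rewrite !inE; case: (eqVneq z pt) => [->|]; last by rewrite orbF andbT.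
by rewrite (negbTE (pt_notin _)) andbF.
Qed.

(** The value [pt] for x or y makes the transposition trivial: the new point is then a cycle of its
    own in the corresponding permutation, counted by u or v. Both sums are split at [pt], and what
    remains according to whether x lies on the cycle of y. *)
Lemma sum_cycle_weight_insert (u v : R) :
  \sum_(x : 'I_n.+1) \sum_(y : 'I_n.+1)
     (if x == pt then u else 1) * (if y == pt then v else 1)
     * cycle_weight (tperm x pt * (tperm y pt * sigma'))%g
  = u * v * f 1 * cycle_weight sigma
    + (u + v) * (\sum_y f #|porbit sigma y|.+1 * rest y)
    + (\sum_y \sum_(1 <= j < #|porbit sigma y|.+1) f j * f (#|porbit sigma y|.+1 - j) * rest y)
    + \sum_y \sum_(x | x \notin porbit sigma y) f (#|porbit sigma x| + #|porbit sigma y|).+1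
         * blocks_weight (porbits sigma :\ porbit sigma y :\ porbit sigma x).
Proof.
have pt_h x : h x == pt = false by apply: negbTE.
have tpt : tperm pt pt = 1%g :> 'S_n.+1 by rewrite tperm1.
pose W x y := cycle_weight (tperm x pt * (tperm y pt * sigma'))%g.
have splitlift (F : 'I_n.+1 -> R) : \sum_x F x = F pt + \sum_x F (h x).
  rewrite (bigD1 pt) //=; congr (_ + _).
  rewrite (reindex_omap h (unlift pt)) /=; last by move=> i;
    rewrite eq_sym => /unlift_some[j e ->]; rewrite e.
  by apply: eq_bigl => j; rewrite hpt /h liftK eqxx.
rewrite splitlift eqxx (splitlift (fun y => _ * W pt y)) eqxx /W tpt !mul1g cycle_weight_lift.
under [X in _ + X + _]eq_bigr => y _ do rewrite pt_h mulr1 mul1g cycle_weight_insert1.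
under [X in _ + X]eq_bigr => x _.
  rewrite splitlift eqxx pt_h mul1r tpt mul1g cycle_weight_insert1.
  under eq_bigr => y _ do rewrite pt_h !mul1r.
  over.
rewrite /= big_split /= -!mulr_sumr exchange_big /=.
under [X in _ + (_ + X)]eq_bigr => y _.
  rewrite (bigID (mem (porbit sigma y))) /= sum_cycle_weight_insert2.
  under [X in _ + X]eq_bigr => x xy do rewrite cycle_weight_insert2 //.
  over.
rewrite /= big_split /=; ring.
Qed.

End Insert.

End CycleWeight.

(** * Inserting a point into a pair of permutations *)

Section PairWeight.
Variables (R : comNzRingType) (u v : R) (f : nat -> R).
Local Open Scope ring_scope.

(** The point x is recovered as the one that the product sends to [ord_max], after which s is
    determined; injectivity and equal cardinals give a bijection. *)
Lemma reindex_insert_perm n (F : 'S_n.+1 -> R) :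
  \sum_r F r = \sum_(s : 'S_n) \sum_(x : 'I_n.+1)
                  F (tperm x ord_max * lift_perm ord_max ord_max s)%g.
Proof.
rewrite pair_big /=.
pose g (p : 'S_n * 'I_n.+1) := (tperm p.2 ord_max * lift_perm ord_max ord_max p.1)%g.
rewrite (reindex g) //; apply/onW_bij/inj_card_bij; last first.
  by rewrite card_prod !card_Sn card_ord factS mulnC.
move=> [s x] [s' x']; rewrite /g /= => e.
have ex : x = x'.
  have e1 : lift_perm ord_max ord_max s' (tperm x' ord_max x) = lift_perm ord_max ord_max s'
    ord_max.
    by rewrite lift_perm_id -permM -e permM tpermL lift_perm_id.
  by rewrite -(tpermK x' ord_max x) (perm_inj e1) tpermR.
rewrite -{}ex in e *; congr (_, _); move/mulgI: e => e.
apply/permP=> i; have := congr1 (fun p : 'S_n.+1 => p (lift ord_max i)) e.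
by rewrite !lift_perm_lift => /lift_inj.
Qed.

(* Of a pair (rho, beta) = (red green^-1, blue green^-1): the cycles of rho, beta and
   rho beta^-1 are the red-green, green-blue and red-blue cycles. *)
Definition pair_weight (T : finType) (p : {perm T} * {perm T}) : R :=
  cycle_weight (fun=> u) p.1 * cycle_weight (fun=> v) p.2 * cycle_weight f (p.1 * p.2^-1)%g.

Lemma cycle_weight_cst_insert (w : R) n (s : 'S_n) x :
  cycle_weight (fun=> w) (tperm x ord_max * lift_perm ord_max ord_max s)%g
  = (if x == ord_max then w else 1) * cycle_weight (fun=> w) s.
Proof.
case: (unliftP ord_max x) => [y|] ->; last by rewrite tperm1 mul1g cycle_weight_lift eqxx.
rewrite cycle_weight_insert1 eq_sym (negbTE (neq_lift _ _)) mul1r.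
by rewrite -(@blocks_weightD1 _ (fun=> w)) ?imset_f.
Qed.

(* The first two brackets come from insertions fixing the new point in at least one of the
   two permutations; the last two from those that split, resp. merge, cycles of sigma. *)
Lemma sum_pair_weightS n :
  \sum_(p : 'S_n.+1 * 'S_n.+1) pair_weight p
  = \sum_(p : 'S_n * 'S_n) cycle_weight (fun=> u) p.1 * cycle_weight (fun=> v) p.2 *
     let sigma := (p.1 * p.2^-1)%g in
     (u * v * f 1 * cycle_weight f sigma
    + (u + v) * (\sum_y f #|porbit sigma y|.+1 * blocks_weight f (porbits sigma :\ porbit sigma
      y))
    + (\sum_y \sum_(1 <= j < #|porbit sigma y|.+1)
          f j * f (#|porbit sigma y|.+1 - j) * blocks_weight f (porbits sigma :\ porbit sigma y))
    + \sum_y \sum_(x | x \notin porbit sigma y) f (#|porbit sigma x| + #|porbit sigma y|).+1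
         * blocks_weight f (porbits sigma :\ porbit sigma y :\ porbit sigma x)).
Proof.
rewrite -(pair_bigA _ (fun r b => pair_weight (r, b))) /= reindex_insert_perm.
under eq_bigr => r _ do under eq_bigr => x _ do rewrite reindex_insert_perm.
under eq_bigr => r _ do rewrite exchange_big /=.
rewrite pair_bigA /=; apply: eq_bigr => -[r b] _ /=.
(* The transposition of beta comes last in rho beta^-1 and moves to the front by conjugation. So y
   takes the role of the outer index, and u and v are exchanged. *)
rewrite [u * v]mulrC [u + v]addrC -sum_cycle_weight_insert exchange_big mulr_sumr /=.
apply: eq_bigr => y _; rewrite mulr_sumr; apply: eq_bigr => x _.
rewrite /pair_weight /= !cycle_weight_cst_insert.
set w1 := cycle_weight f _; set w2 := cycle_weight f _.
suff -> : w1 = w2.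
  move: w2 (if _ then u else _) (if _ then v else _) (cycle_weight _ r) (cycle_weight _ b).
  by clear => w2 a c d e; ring.
rewrite /w1 /w2 invMg tpermV lift_permV mulgA cycle_weightM; congr cycle_weight.
by rewrite -(lift_permM ord_max ord_max) !mulgA.
Qed.

End PairWeight.

(** Turns a choice of insertion points into a choice of cycles; the multiplicities [#|C|] become the
    numerical factors of the operators. *)
Lemma sum_porbits (R : nmodType) (T : finType) (s : {perm T}) (F : {set T} -> R) :
  (\sum_y F (porbit s y) = \sum_(C in porbits s) F C *+ #|C|)%R.
Proof.
rewrite (partition_big_imset (porbit s)) /= -/(porbits s); apply: eq_bigr => C /imsetP[x _ ->].
rewrite (eq_bigr (fun=> F (porbit s x))) => [|y /eqP->//].
rewrite sumr_const; congr (_ *+ _)%R; apply: eq_card => y.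
by rewrite -eq_porbit_mem.
Qed.

Lemma sum_nat_pick (R : nmodType) (F : nat -> R) m n' k : (m <= k < n')%N ->
  (\sum_(m <= i < n') (if k == i then F i else 0) = F k)%R.
Proof.
move=> kmn; rewrite -big_mkcond /= (eq_bigl (fun i => i == k)) => [|i]; last exact: eq_sym.
by rewrite (big_nat1_eq _ F) kmn.
Qed.

(** * The operators L_1, M_1, Q_1 on polynomials and their action on cycle weights *)

Section Operators.
Variable N : nat.
Local Open Scope ring_scope.
Local Notation K := {mpoly rat[N.+3]}.

Definition sidx : 'I_N.+3 := ord0.
Definition uidx : 'I_N.+3 := inord 1.
Definition vidx : 'I_N.+3 := inord 2.
(** The variables are ordered as s, u, v, t_1, ..., t_N. The value i = 0 would give v, and by
    [inord] a value beyond N gives s; this is the origin of the range hypotheses below. *)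
Definition tidx (i : nat) : 'I_N.+3 := inord i.+2.

(* t_i, with the variables t_i for i > N set to 0: permutations of at most N points
   only need t_1, ..., t_N. *)
Definition tvar (i : nat) : K := if (0 < i <= N)%N then 'X_(tidx i) else 0.

Lemma tidxE i : (i <= N)%N -> tidx i = i.+2 :> nat.
Proof. by move=> iN; rewrite inordK. Qed.

Lemma mderiv_tvar i j : (0 < j <= N)%N -> (i <= N)%N ->
  (tvar i)^`M(tidx j) = (i == j)%:R.
Proof.
move=> /andP[j0 jN] iN; rewrite /tvar iN andbT; case: posnP => [->|i0].
  by rewrite mderiv0 eq_sym gtn_eqF.
rewrite mderivX mnm1E -val_eqE /= !tidxE // !eqSS; case: eqP => [->|]; last by rewrite scale0r.
have -> : (U_(tidx j) - U_(tidx j) = 0)%MM by apply/mnmP=> k; rewrite mnmBE mnm0E subnn.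
by rewrite scale1r mpolyX0.
Qed.

Lemma mderiv_prod (I : finType) (X : {set I}) (F : I -> K) k :
  (\prod_(i in X) F i)^`M(k) = \sum_(i in X) (F i)^`M(k) * \prod_(j in X :\ i) F j.
Proof.
elim: {X}#|X| {-2}X (erefl #|X|) => [|n IHn] X cX.
  have/eqP := cX; rewrite cards_eq0 => /eqP->; rewrite !big_set0.
  by rewrite -mpolyC1 mderivC.
have [x xX] : exists x, x \in X by apply/set0Pn; rewrite -card_gt0 cX.
rewrite (big_setD1 x xX) /= mderivM IHn; last by move: cX; rewrite (cardsD1 x) xX => -[].
rewrite [RHS](big_setD1 x xX) /= mulr_sumr; congr (_ + _).
apply: eq_bigr => i; rewrite in_setD1 => /andP[ix iX].
have xXi : x \in X :\ i by rewrite in_setD1 xX eq_sym ix.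
by rewrite (big_setD1 x xXi) /= mulrCA setD1C.
Qed.

Lemma mderiv_blocks_weight (T : finType) (X : {set {set T}}) j : (0 < j <= N)%N ->
  {in X, forall C : {set T}, (#|C| <= N)%N} ->
  (blocks_weight tvar X)^`M(tidx j)
    = \sum_(C in X) (#|C| == j)%:R * blocks_weight tvar (X :\ C).
Proof.
move=> jN XN; rewrite mderiv_prod; apply: eq_bigr => C CX.
by rewrite mderiv_tvar ?XN.
Qed.

(** In this range i - 1 runs through 1, ..., N, so every derivative occurs; the term with t_(N+1) is
    killed by [tvar]. *)
Definition opL (p : K) : K := \sum_(2 <= i < N.+2) i.-1%:R * (tvar i * p^`M(tidx i.-1)).

Definition opM (p : K) : K := \sum_(2 <= i < N.+2) \sum_(1 <= j < i)
  (i.-1%:R * (tvar j * (tvar (i - j) * p^`M(tidx i.-1)))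
   + (j * (i - j))%:R * (tvar i.+1 * p^`M(tidx (i - j))^`M(tidx j))).

Definition opQ (p : K) : K := \sum_(2 <= i < N.+2) \sum_(1 <= j < i)
  (j * (i - j))%:R * (tvar i.+1 * (p^`M(tidx j) * p^`M(tidx (i - j)))).

Section Action.
Variables (n : nat) (sigma : 'S_n).
Hypothesis nN : (n <= N)%N.

Let card_block (C : {set 'I_n}) : C \in porbits sigma -> (0 < #|C| <= N)%N.
Proof.
case/imsetP=> x _ ->; rewrite lt0n card_porbit_neq0 /=.
by rewrite (leq_trans _ nN) // (leq_trans (max_card _)) // card_ord.
Qed.

(** The derivative by t_i selects a cycle of length i, the factor i selects a point y on it, and
    t_(i+1) is the weight of that cycle with the new point added. *)
Lemma opL_cycle_weight : opL (cycle_weight tvar sigma)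
  = \sum_y tvar #|porbit sigma y|.+1 * blocks_weight tvar (porbits sigma :\ porbit sigma y).
Proof.
rewrite (sum_porbits sigma (fun C => tvar #|C|.+1 * blocks_weight tvar (porbits sigma :\ C))).
rewrite /opL big_add1 /=.
have E i : (1 <= i < N.+1)%N -> i%:R * (tvar i.+1 * (cycle_weight tvar sigma)^`M(tidx i))
  = \sum_(C in porbits sigma) if #|C| == i then tvar #|C|.+1 * blocks_weight tvar (porbits
    sigma :\ C) *+ #|C| else 0.
  move=> iN; rewrite mderiv_blocks_weight //; last by move=> C /card_block/andP[].
  rewrite !mulr_sumr; apply: eq_bigr => C _; case: eqP => [->|_]; last by rewrite mul0r !mulr0.
  by rewrite mul1r mulr_natl.
rewrite (eq_big_nat _ _ E) exchange_big /=; apply: eq_bigr => C /card_block CN.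
by rewrite (sum_nat_pick (fun=> _)).
Qed.

(** Every cycle contributes a single variable, so two derivatives remove an ordered pair of distinct
    cycles. *)
Lemma mderiv2_cycle_weight i j : (0 < i <= N)%N -> (0 < j <= N)%N ->
  (cycle_weight tvar sigma)^`M(tidx i)^`M(tidx j)
  = \sum_(C in porbits sigma) \sum_(D in porbits sigma :\ C)
      if (#|C| == i) && (#|D| == j) then blocks_weight tvar (porbits sigma :\ C :\ D) else 0.
Proof.
move=> iN jN; rewrite mderiv_blocks_weight //; last by move=> C /card_block/andP[].
rewrite raddf_sum /=; apply: eq_bigr => C CP.
case: eqP => Ci /=; last by rewrite mul0r mderiv0 big1.
rewrite mul1r mderiv_blocks_weight //; last first.
  by move=> D; rewrite in_setD1 => /andP[_ /card_block/andP[]].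
by apply: eq_bigr => D _; case: eqP => _ /=; rewrite ?mul1r ?mul0r.
Qed.

(** The first-order part cuts a cycle that has received the new point; the second-order part joins
    two cycles through it, and j (i - j) counts the choices of a point on each. *)
Lemma opM_cycle_weight : opM (cycle_weight tvar sigma)
  = (\sum_y \sum_(1 <= j < #|porbit sigma y|.+1)
       tvar j * tvar (#|porbit sigma y|.+1 - j) * blocks_weight tvar (porbits sigma :\ porbit
         sigma y))
    + \sum_y \sum_(x | x \notin porbit sigma y) tvar (#|porbit sigma x| + #|porbit sigma y|).+1
         * blocks_weight tvar (porbits sigma :\ porbit sigma y :\ porbit sigma x).
Proof.
rewrite /opM; under eq_bigr => i _ do rewrite big_split /=.
rewrite big_split /=; congr (_ + _).
  rewrite (sum_porbits sigma (fun C => \sum_(1 <= j < #|C|.+1)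
       tvar j * tvar (#|C|.+1 - j) * blocks_weight tvar (porbits sigma :\ C))).
  rewrite big_add1 /=.
  have E i : (1 <= i < N.+1)%N ->
    \sum_(1 <= j < i.+1) i%:R * (tvar j * (tvar (i.+1 - j) * (cycle_weight tvar sigma)^`M(tidx
      i)))
    = \sum_(C in porbits sigma) if #|C| == i then (\sum_(1 <= j < #|C|.+1)
       tvar j * tvar (#|C|.+1 - j) * blocks_weight tvar (porbits sigma :\ C)) *+ #|C| else 0.
    move=> iN; rewrite mderiv_blocks_weight //; last by move=> C /card_block/andP[].
    under eq_bigr => j _ do rewrite !mulr_sumr.
    rewrite exchange_big /=; apply: eq_bigr => C _.
    case: eqP => [->|_]; last by rewrite big1 // => j _; rewrite mul0r !mulr0.
    rewrite -[RHS]mulr_natl mulr_sumr; apply: eq_bigr => j _.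
    by rewrite mul1r !mulrA.
  rewrite (eq_big_nat _ _ E) exchange_big /=; apply: eq_bigr => C /card_block CN.
  by rewrite (sum_nat_pick (fun=> _)).
pose G (C D : {set 'I_n}) := tvar (#|D| + #|C|).+1 * blocks_weight tvar (porbits sigma :\ C :\ D).
transitivity (\sum_(C in porbits sigma) \sum_(D in porbits sigma :\ C) G C D *+ #|D| *+ #|C|);
  last first.
  rewrite -/(G _ _) (eq_bigr (fun y => \sum_(D in porbits sigma :\ porbit sigma y) G (porbit
    sigma y) D *+ #|D|)).
    rewrite (sum_porbits sigma (fun C => \sum_(D in porbits sigma :\ C) G C D *+ #|D|)).
    by apply: eq_bigr => C _; rewrite sumrMnl.
  move=> y _; rewrite big_mkcond /=.
  rewrite (eq_bigr (fun x => if porbit sigma x != porbit sigma y then G (porbit sigma y)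
    (porbit sigma x) else 0)).
    rewrite (sum_porbits sigma (fun D => if D != porbit sigma y then G (porbit sigma y) D else
      0)).
    rewrite [RHS](eq_bigl (fun D => (D \in porbits sigma) && (D != porbit sigma y))).
      by rewrite big_mkcondr; apply: eq_bigr => D _; case: ifP; rewrite ?mul0rn.
    by move=> D; rewrite !inE andbC.
  by move=> x _; rewrite eq_porbit_mem.
(* An ordered pair (C, D) survives for a single i, namely |D| + |C|, and then for a single j, namely
   |D|; the two sums are collapsed in this order. *)
rewrite (eq_big_nat _ _ (F2 := fun i => \sum_(C in porbits sigma) \sum_(D in porbits sigma :\ C)
    if (#|D| + #|C|)%N == i then G C D *+ #|D| *+ #|C| else 0)).
  rewrite exchange_big /=; apply: eq_bigr => C CP; rewrite exchange_big /=; apply: eq_bigr => D.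
  rewrite in_setD1 => /andP[DC DP]; rewrite (sum_nat_pick (fun=> _)) //.
  have /andP[C0 _] := card_block CP; have /andP[D0 _] := card_block DP.
  (* Distinct cycles are disjoint, so |D| + |C| is at most n and stays in the range of i. *)
  have : (#|D :|: C| <= n)%N by rewrite -[X in (_ <= X)%N]card_ord max_card.
  rewrite cardsU disjoint_setI0 ?cards0.
    rewrite subn0 => H; rewrite (leq_add D0 C0) /=.
    by apply: leq_ltn_trans H _; rewrite ltnS leqW.
  move: DC DP CP => /[swap] /imsetP[x _ ->] /[swap] /imsetP[y _ ->] xy.
  rewrite disjoints_subset; apply/subsetP=> z; rewrite inE -!eq_porbit_mem => /eqP->.
  by rewrite eq_porbit_mem porbit_sym -eq_porbit_mem eq_sym.
move=> i iN.
rewrite (eq_big_nat _ _ (F2 := fun j => \sum_(C in porbits sigma) \sum_(D in porbits sigma :\ C)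
    if #|D| == j then (if (#|D| + #|C|)%N == i then G C D *+ #|D| *+ #|C| else 0) else 0)).
  rewrite exchange_big /=; apply: eq_bigr => C CP; rewrite exchange_big /=; apply: eq_bigr => D.
  rewrite in_setD1 => /andP[DC DP]; case: eqP => [ei|]; last first.
    by move=> _; rewrite big1 // => j _; case: ifP.
  rewrite (sum_nat_pick (fun=> _)) //.
  have /andP[C0 _] := card_block CP; have /andP[D0 _] := card_block DP.
  by rewrite D0 -ei -[X in (X < _)%N]addn0 ltn_add2l.
move=> j ji; rewrite mderiv2_cycle_weight; [|by move: iN ji; clear; lia..].
rewrite !mulr_sumr; apply: eq_bigr => C _; rewrite !mulr_sumr; apply: eq_bigr => D _.
case: (eqVneq #|D| j) => [Dj|]; last by rewrite andbF !mulr0.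
have /andP[_ /ltnW ji'] := ji.
rewrite andbT Dj -(eqn_add2l j) subnKC //.
case: eqP => [e|_]; last by rewrite !mulr0.
have -> : (i - j)%N = #|C| by rewrite -e addKn.
by rewrite -e -Dj /G -mulrnA mulr_natl.
Qed.

End Action.

End Operators.

(** * Splitting off the connected component of a point *)

Section Components.
Variable T : finType.
Implicit Types (p : {perm T} * {perm T}) (S : {set T}).

(** Equality of memberships, rather than one inclusion, makes the notion invariant under
    complement. *)
Definition stable p S :=
  [forall x, ((p.1 x \in S) == (x \in S)) && ((p.2 x \in S) == (x \in S))].

Lemma stableP p S :
  reflect (forall x, (p.1 x \in S) = (x \in S) /\ (p.2 x \in S) = (x \in S)) (stable p S).
Proof.
by apply: (iffP forallP) => sS x; have := sS x; [case/andP=> /eqP-> /eqP->|case=> -> ->;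
  rewrite !eqxx].
Qed.

Lemma stableC p S : stable p (~: S) = stable p S.
Proof. by apply: eq_forallb => x; rewrite !inE !(inj_eq negb_inj). Qed.

Definition transitive_pair p := [forall S, stable p S ==> (S == set0) || (S == setT)].

(** The orbit of x under the group generated by the two permutations, obtained as the smallest
    stable set. *)
Definition component p x := \bigcap_(S | stable p S && (x \in S)) S.

Lemma component_id p x : x \in component p x.
Proof. by apply/bigcapP=> S /andP[]. Qed.

Lemma stable_component p x : stable p (component p x).
Proof.
apply/stableP=> y; split; apply/bigcapP/bigcapP => H S SP; have := H S SP;
  by case/andP: SP => /stableP/(_ y)[e1 e2] _; rewrite ?e1 ?e2.
Qed.

Lemma component_sub p x S : stable p S -> x \in S -> component p x \subset S.
Proof. by move=> sS xS; apply: bigcap_inf; rewrite sS. Qed.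
End Components.

Section Join.
Variables (T1 T2 T : finType) (h1 : T1 -> T) (h2 : T2 -> T).
Hypotheses (h1I : injective h1) (h2I : injective h2) (h12 : forall x y, h1 x != h2 y).
Hypothesis hc : forall z, (exists x, z = h1 x) \/ (exists x, z = h2 x).

Section Fun.
Variables (s1 : {perm T1}) (s2 : {perm T2}).

(** The default z is never reached, by [hc]. *)
Definition join_fun z :=
  if [pick x | h1 x == z] is Some x then h1 (s1 x)
  else if [pick x | h2 x == z] is Some x then h2 (s2 x) else z.

Lemma join_fun1 x : join_fun (h1 x) = h1 (s1 x).
Proof.
rewrite /join_fun; case: pickP => [y /eqP/h1I->//|/(_ x)]; by rewrite eqxx.
Qed.

Lemma join_fun2 x : join_fun (h2 x) = h2 (s2 x).
Proof.
rewrite /join_fun; case: pickP => [y /eqP e|_]; first by have := h12 y x; rewrite e eqxx.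
by case: pickP => [y /eqP/h2I->//|/(_ x)]; rewrite eqxx.
Qed.

Lemma join_fun_inj : injective join_fun.
Proof.
move=> z z'; case: (hc z) => -[x ->]; case: (hc z') => -[y ->]; rewrite ?join_fun1 ?join_fun2.
- by move/h1I/perm_inj->.
- by move/eqP; rewrite (negbTE (h12 _ _)).
- by move/esym/eqP; rewrite (negbTE (h12 _ _)).
- by move/h2I/perm_inj->.
Qed.

Definition join_perm := perm join_fun_inj.

Lemma join_perm1 x : join_perm (h1 x) = h1 (s1 x).
Proof. by rewrite permE join_fun1. Qed.

Lemma join_perm2 x : join_perm (h2 x) = h2 (s2 x).
Proof. by rewrite permE join_fun2. Qed.
End Fun.

Lemma restrict_perm (T' : finType) (h : T' -> T) (s : {perm T}) : injective h ->
  (forall x, s (h x) \in codom h) -> exists s' : {perm T'}, forall x, s (h x) = h (s' x).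
Proof.
move=> hI sh; pose g x := iinv (sh x).
have gE x : h (g x) = s (h x) by rewrite f_iinv.
have gI : injective g by move=> x y e; apply/hI/(@perm_inj _ s); rewrite -!gE e.
by exists (perm gI) => x; rewrite permE gE.
Qed.

Lemma join_perm_inj s1 s2 s1' s2' :
  join_perm s1 s2 = join_perm s1' s2' -> s1 = s1' /\ s2 = s2'.
Proof.
move=> /permP e; split; apply/permP=> x.
  by apply: h1I; rewrite -(join_perm1 s1 s2) e join_perm1.
by apply: h2I; rewrite -(join_perm2 s1 s2) e join_perm2.
Qed.

Lemma join_perm_surj (s : {perm T}) (S : {set T}) : S =i codom h1 ->
  (forall z, (s z \in S) = (z \in S)) -> exists s1 s2, s = join_perm s1 s2.
Proof.
move=> SE sS.
have [x|s1 e1] := restrict_perm (s := s) h1I; first by rewrite -SE sS SE codom_f.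
have [x|s2 e2] := restrict_perm (s := s) h2I.
  (* A point outside S stays outside, since [s] does not change membership in S. *)
  case: (hc (s (h2 x))) => -[y e]; last by rewrite e codom_f.
  have: h2 x \in S by rewrite -sS e SE codom_f.
  by rewrite SE => /codomP[z ez]; have := h12 z x; rewrite ez eqxx.
exists s1, s2; apply/permP=> z; case: (hc z) => -[x ->]; first by rewrite join_perm1.
by rewrite join_perm2.
Qed.

Definition join_pair (q : ({perm T1} * {perm T1}) * ({perm T2} * {perm T2})) :=
  (join_perm q.1.1 q.2.1, join_perm q.1.2 q.2.2).

Lemma join_pair_inj : injective join_pair.
Proof.
move=> [[a b] [c d]] [[a' b'] [c' d']] [] /= /join_perm_inj[<- <-] /join_perm_inj[<- <-] //.
Qed.

Lemma stable_join q (A : {set T1}) : stable (join_pair q) (h1 @: A) = stable q.1 A.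
Proof.
apply/stableP/stableP => sA x.
  by have := sA (h1 x); rewrite /= !join_perm1 !(mem_imset _ _ h1I).
have n2 y : h2 y \in h1 @: A = false.
  by apply/imsetP=> -[z _ /esym/eqP]; rewrite (negbTE (h12 _ _)).
case: (hc x) => -[y ->] /=; rewrite ?join_perm1 ?join_perm2 ?n2 //.
by rewrite !(mem_imset _ _ h1I); apply: sA.
Qed.

(* Stable sets are closed under complement, so a stable set avoiding [h1 x0] is excluded
   by its complement. *)
Lemma component_join q x0 :
  (component (join_pair q) (h1 x0) == h1 @: setT) = transitive_pair q.1.
Proof.
set J := join_pair q.
have sT : stable J (h1 @: setT) by rewrite stable_join; apply/stableP=> x; rewrite !inE.
have sub : component J (h1 x0) \subset h1 @: setT by apply: component_sub; rewrite ?imset_f ?inE.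
apply/eqP/forallP => [e A|tr].
  apply/implyP=> sA.
  have main B : stable q.1 B -> x0 \in B -> B = setT.
    move=> sB x0B; apply/setP=> x; rewrite inE.
    have /subsetP/(_ (h1 x)) : component J (h1 x0) \subset h1 @: B.
      by apply: component_sub; rewrite ?stable_join ?imset_f.
    by rewrite e !(mem_imset _ _ h1I) inE => ->.
  have [x0A|x0A] := boolP (x0 \in A); first by rewrite (main A) ?eqxx ?orbT.
  by rewrite -[A]setCK (main (~: A)) ?stableC ?inE // setCT eqxx.
apply/eqP; rewrite eqEsubset sub /=.
have e : component J (h1 x0) = h1 @: (h1 @^-1: component J (h1 x0)).
  apply/setP=> z; apply/idP/imsetP => [zc|[x]]; last by rewrite inE => ? ->.
  by have /subsetP/(_ z zc)/imsetP[x _ ez] := sub; exists x; rewrite // inE -ez.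
have := tr (h1 @^-1: component J (h1 x0)); rewrite -stable_join -/J -e stable_component /=.
case/orP=> /eqP E; last by rewrite e E.
by have := component_id J (h1 x0); rewrite e E imset0 inE.
Qed.

Variables (R : comNzRingType) (u v : R) (f : nat -> R).

Lemma pair_weight_join q : pair_weight u v f (join_pair q) = (pair_weight u v f q.1 *
  pair_weight u v f q.2)%R.
Proof.
rewrite /pair_weight.
rewrite (cycle_weight_union _ h1I h2I h12 hc (join_perm1 q.1.1 q.2.1) (join_perm2 q.1.1 q.2.1)).
rewrite (cycle_weight_union _ h1I h2I h12 hc (join_perm1 q.1.2 q.2.2) (join_perm2 q.1.2 q.2.2)).
rewrite (@cycle_weight_union _ f _ _ _ h1 h2 (q.1.1 * q.1.2^-1)%g (q.2.1 * q.2.2^-1)%g _ h1I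
  h2I h12 hc).
- move: (cycle_weight _ _) (cycle_weight _ _) (cycle_weight _ _) (cycle_weight _ _)
  (cycle_weight _ _) (cycle_weight _ _).
  by clear; move=> a b c d e g; ring.
- move=> x; rewrite !permM /= join_perm1; apply: (@perm_inj _ (join_perm q.1.2 q.2.2)).
  by rewrite permKV join_perm1 permKV.
- move=> x; rewrite !permM /= join_perm2; apply: (@perm_inj _ (join_perm q.1.2 q.2.2)).
  by rewrite permKV join_perm2 permKV.
Qed.

(** [join_pair] is a bijection onto the pairs on the left: the component is stable, so both
    permutations restrict to it and to its complement, and the restriction to the complement is
    arbitrary. *)
Lemma sum_pair_weight_component x0 :
  (\sum_(p | component p (h1 x0) == h1 @: setT) pair_weight u v f p
   = (\sum_(p : {perm T1} * {perm T1} | transitive_pair p) pair_weight u v f p) * \sum_(p :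
     {perm T2} * {perm T2}) pair_weight u v f p)%R.
Proof.
rewrite big_distrlr /= pair_big /=.
rewrite (eq_bigl (mem (join_pair @: [set q | transitive_pair q.1]))) => [|p].
  rewrite big_imset /=; last by move=> ? ? _ _; apply: join_pair_inj.
  by apply: eq_big => [q|q _]; rewrite ?inE ?andbT ?pair_weight_join.
rewrite !inE; apply/idP/imsetP => [e|[q]]; last by rewrite inE -(component_join _ x0) => ? ->.
have sS z := stableP _ _ (stable_component p (h1 x0)) z.
have cE : component p (h1 x0) =i codom h1.
  rewrite (eqP e) => z; apply/imsetP/codomP => [[x _ ->]|[x ->]]; by exists x.
have [s1 [s2 e1]] := join_perm_surj cE (fun z => (sS z).1).
have [t1 [t2 e2]] := join_perm_surj cE (fun z => (sS z).2).
have pE : p = join_pair ((s1, t1), (s2, t2)) by rewrite /join_pair /= -e1 -e2; case: (p).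
exists ((s1, t1), (s2, t2)) => //.
by rewrite inE -(component_join _ x0) -pE.
Qed.

End Join.

Section Decomposition.
Variables (R : comNzRingType) (u v : R) (f : nat -> R).
Local Open Scope ring_scope.

Definition wsum n : R := \sum_(p : 'S_n * 'S_n) pair_weight u v f p.
Definition wsum_conn n : R := \sum_(p : 'S_n * 'S_n | transitive_pair p) pair_weight u v f p.

Lemma sum_component_set n (S : {set 'I_n}) x0 : x0 \in S ->
  \sum_(p | component p x0 == S) pair_weight u v f p = wsum_conn #|S| * wsum (n - #|S|).
Proof.
move=> x0S; pose h1 : 'I_#|S| -> 'I_n := enum_val; pose h2 : 'I_#|~: S| -> 'I_n := enum_val.
have h1T : h1 @: setT = S.
  apply/setP=> z; apply/imsetP/idP => [[x _ ->]|zS]; first exact: enum_valP.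
  by exists (enum_rank_in x0S z); rewrite // /h1 enum_rankK_in.
have [a0 e0] : exists a, x0 = h1 a.
  have : x0 \in h1 @: setT by rewrite h1T.
  by case/imsetP=> a _ ->; exists a.
rewrite e0; under eq_bigl => p do rewrite -[X in _ == X]h1T.
have -> : (n - #|S|)%N = #|~: S| by rewrite [RHS]cardsCs setCK card_ord.
apply: sum_pair_weight_component; try exact: enum_val_inj.
  move=> x y; apply/eqP=> e; have := enum_valP y.
  by rewrite -e inE (enum_valP x).
move=> z; have [zS|zS] := boolP (z \in S); [left|right].
  by exists (enum_rank_in zS z); rewrite /h1 enum_rankK_in.
have zC : z \in ~: S by rewrite inE.
by exists (enum_rank_in zC z); rewrite /h2 enum_rankK_in.
Qed.

(** A set of e + 1 elements containing x0 is x0 added to e of the n other points. *)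
Lemma sum_sets_with n (x0 : 'I_n.+1) (F : nat -> R) :
  \sum_(S : {set 'I_n.+1} | x0 \in S) F #|S| = \sum_(e < n.+1) 'C(n, e)%:R * F e.+1.
Proof.
rewrite (partition_big (fun S : {set 'I_n.+1} => inord (#|S|.-1) : 'I_n.+1) predT) //=.
apply: eq_bigr => e _; rewrite mulr_natl.
have cE (S : {set 'I_n.+1}) : x0 \in S -> (inord #|S|.-1 == e) = (#|S| == e.+1).
  move=> xS; have S0 : (0 < #|S|)%N by apply/card_gt0P; exists x0.
  have Sn : (#|S|.-1 < n.+1)%N by rewrite prednK // -[X in (_ <= X)%N]card_ord max_card.
  by rewrite -val_eqE /= inordK // -(eqn_pmul2l (isT : (0 < 1)%N)) !mul1n -eqSS prednK.
rewrite (eq_bigr (fun=> F e.+1)) => [|S /andP[xS]]; last by rewrite cE // => /eqP->.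
rewrite sumr_const; congr (_ *+ _).
have cX : #|[set~ x0]| = n by rewrite cardsC1 card_ord.
rewrite -[X in 'C(X, _)]cX -cards_draws.
rewrite -(card_in_imset (f := fun B => x0 |: B) (D := mem [set B : {set 'I_n.+1} | (B \subset
  [set~ x0]) && (#|B| == e)])).
  apply: eq_card => S; apply/andP/imsetP => [[xS]|[B]].
    rewrite cE // => /eqP cS; exists (S :\ x0); last by rewrite setD1K.
    rewrite inE; apply/andP; split; first by apply/subsetP=> z; rewrite !inE => /andP[].
    by move: cS; rewrite (cardsD1 x0) xS add1n => -[->].
  rewrite inE => /andP[/subsetP Bx /eqP cB] ->; rewrite setU11 cE ?setU11 //.
  have xB : x0 \notin B by apply/negP=> /Bx; rewrite !inE eqxx.
  by rewrite cardsU1 xB cB.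
move=> B B'; rewrite !inE => /andP[/subsetP Bx _] /andP[/subsetP Bx' _] e'.
have xB : x0 \notin B by apply/negP=> /Bx; rewrite !inE eqxx.
have xB' : x0 \notin B' by apply/negP=> /Bx'; rewrite !inE eqxx.
by rewrite -(setU1K xB) e' setU1K.
Qed.

(** The pairs are sorted by the component of [ord0]. If it has e + 1 points, the binomial counts the
    possible components and n - e points are left. *)
Lemma wsumS_conn n :
  wsum n.+1 = \sum_(e < n.+1) 'C(n, e)%:R * (wsum_conn e.+1 * wsum (n - e)).
Proof.
rewrite -(sum_sets_with ord0 (fun k => wsum_conn k * wsum (n.+1 - k))).
rewrite /wsum (partition_big (fun p => component p ord0) (fun S => ord0 \in S)) /=; last first.
  by move=> p _; apply: component_id.
by apply: eq_bigr => S xS; rewrite sum_component_set.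
Qed.

End Decomposition.

(** * Belyi graphs as pairs of permutations *)

Lemma connect_invariant (V : finType) (W : eqType) (e : rel V) (k : V -> W) :
  (forall x y, e x y -> k x = k y) -> forall x y, connect e x y -> k x = k y.
Proof.
move=> ek x y /connectP[p ep ->]; elim: p x ep => //= z p IHp x /andP[/ek-> /IHp].
by [].
Qed.

Section TwoColours.
Variables (d : nat) (p q : 'S_d).
Let e : rel ('I_d + 'I_d) := badj [:: p; q].

Definition to_white (g : 'S_d) (x : 'I_d + 'I_d) : 'I_d :=
  match x with inl w => w | inr v => (g^-1)%g v end.

Lemma badj_sym (cols : seq 'S_d) : ssrbool.symmetric (badj cols).
Proof. by case=> x [] y. Qed.

Lemma connect_badjC (cols : seq 'S_d) x y : connect (badj cols) x y = connect (badj cols) y x.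
Proof. exact/sym_connect_sym/badj_sym. Qed.

Lemma connect_to_white (cols : seq 'S_d) g x : g \in cols ->
  connect (badj cols) x (inl (to_white g x)).
Proof.
move=> gc; case: x => [w|v] /=; first exact: connect0.
by apply: connect1; apply/hasP; exists g; rewrite ?permKV.
Qed.

Lemma connect_badj_step (cols : seq 'S_d) g h w : g \in cols -> h \in cols ->
  connect (badj cols) (inl w) (inl ((h * g^-1)%g w)).
Proof.
move=> gc hc; apply: (@connect_trans _ _ (inr (h w))).
  by apply: connect1; apply/hasP; exists h.
by rewrite permM; exact: (connect_to_white (inr (h w)) gc).
Qed.

(** One step of [p * q^-1] goes along p to a black vertex and back along q, so the white vertices of
    a component form a cycle; a black vertex is represented by its q-neighbour. *)
Lemma connect_badj2 x y :
  connect e x y = (to_white q y \in porbit (p * q^-1) (to_white q x))%g.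
Proof.
rewrite -eq_porbit_mem; apply/idP/eqP => [/connect_invariant|exy].
  move=> /(_ _ (fun x => porbit (p * q^-1)%g (to_white q x))) -> //.
  suff H w v : e (inl w) (inr v) -> porbit (p * q^-1)%g w = porbit (p * q^-1)%g ((q^-1)%g v).
    by case=> w [] v //= E; [exact: H | apply/esym/H; rewrite /e badj_sym].
  case/hasP=> r; rewrite !inE => /orP[]/eqP-> /eqP<-; last by rewrite permK.
  by rewrite -permM porbit_perm1.
have qc : q \in [:: p; q] by rewrite !inE eqxx orbT.
apply: (connect_trans (connect_to_white x qc)).
rewrite connect_badjC; apply: (connect_trans (connect_to_white y qc)).
have : (to_white q x \in porbit (p * q^-1) (to_white q y))%g by rewrite -eq_porbit_mem exy.
case/porbitP=> i ->; elim: i => [|i IHi]; first by rewrite expg0 perm1 connect0.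
apply: (connect_trans IHi); rewrite expgSr permM; apply: connect_badj_step => //.
by rewrite inE eqxx.
Qed.

Lemma card_connect_badj2 x :
  #|[pred y | connect e x y]| = #|porbit (p * q^-1)%g (to_white q x)|.*2.
Proof.
set C := porbit _ _.
have inE' y : (y \in [pred y | connect e x y]) = (to_white q y \in C) by rewrite inE
  connect_badj2.
rewrite -addnn (eq_card inE') -!sum1_card big_sumType /=; congr (_ + _).
rewrite (reindex_inj (@perm_inj _ q)); apply: eq_bigl => v /=.
by rewrite /in_mem /= permK.
Qed.

(** Every component has exactly one root, so roots enumerate the components, that is, the cycles. *)
Lemma card_roots_badj2 (P : pred {set 'I_d}) :
  #|[pred x | roots e x && P (porbit (p * q^-1)%g (to_white q x))]|
  = #|[set C in porbits (p * q^-1)%g | P C]|.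
Proof.
set s := (p * q^-1)%g.
have cs : connect_sym e by apply/sym_connect_sym/badj_sym.
rewrite -(card_in_imset (f := fun x => porbit s (to_white q x))).
  apply: eq_card => C; rewrite inE; apply/imsetP/andP => [[x]|[/imsetP[w _ ->] Pw]].
    by rewrite inE => /andP[_ Px] ->; rewrite imset_f.
  have E : porbit s (to_white q (fingraph.root e (inl w))) = porbit s w.
    by apply/eqP; rewrite eq_porbit_mem -(connect_badj2 (inl w)) connect_root.
  by exists (fingraph.root e (inl w)); rewrite ?inE ?E ?roots_root.
move=> x y; rewrite !inE => /andP[rx _] /andP[ry _] /eqP.
rewrite eq_porbit_mem -connect_badj2 => /(fingraph.rootP cs) H.
by rewrite -(eqP (rx : fingraph.root e x == x)) -(eqP (ry : fingraph.root e y == y)) H.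
Qed.
End TwoColours.

Definition cycles_of_length d (s : 'S_d) i := #|[set C in porbits s | #|C| == i]|.
Definition cycle_type d (s : 'S_d) := [seq cycles_of_length s i | i <- iota 1 d].

Definition pair_has_type d (p : 'S_d * 'S_d) k l m :=
  [&& #|porbits p.1| == k, #|porbits p.2| == l & trim (cycle_type (p.1 * p.2^-1)%g) == trim m].

(* Identifies the black vertices with the white ones along the green edges. *)
Definition gauge d (G : btriple d) : 'S_d * 'S_d :=
  (bred G * (bgreen G)^-1, bblue G * (bgreen G)^-1)%g.

Lemma n_comp_badj2 d (p q : 'S_d) :
  n_comp (badj [:: p; q]) predT = #|porbits (p * q^-1)%g|.
Proof.
have := card_roots_badj2 p q predT; rewrite /n_comp_mem.
rewrite (_ : [set C in _ | predT C] = porbits (p * q^-1)%g) => [<-|].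
  by apply: eq_card => x; rewrite !inE.
by apply/setP=> C; rewrite inE andbT.
Qed.

Lemma has_type_gauge d (G : btriple d) k l m : has_type G k l m = pair_has_type (gauge G) k l m.
Proof.
rewrite /has_type /pair_has_type /bk /bl !n_comp_badj2 /=.
have eV : (bgreen G * (bblue G)^-1 = (bblue G * (bgreen G)^-1)^-1)%g by rewrite invMg invgK.
have eB : (bred G * (bgreen G)^-1 * (bblue G * (bgreen G)^-1)^-1 = bred G * (bblue G)^-1)%g.
  by rewrite invMg invgK mulgA mulgKV.
rewrite eV porbitsV eB; congr (_ && (_ && (trim _ == _))).
apply: eq_map => i; rewrite /bm /cycles_of_length -(card_roots_badj2 _ _ (fun C => #|C| == i)).
apply: eq_card => x; rewrite !inE; congr (_ && _).
by rewrite card_connect_badj2 (inj_eq double_inj).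
Qed.

Lemma bconnected_gauge d (G : btriple d) : bconnected G = transitive_pair (gauge G).
Proof.
set cols := [:: bblue G; bgreen G; bred G].
have gc : bgreen G \in cols by rewrite !inE eqxx orbT.
have bc : bblue G \in cols by rewrite !inE eqxx.
have rc : bred G \in cols by rewrite !inE eqxx !orbT.
pose pi := to_white (bgreen G).
apply/forallP/forallP => [con A|tr x].
  apply/implyP=> /stableP sA; rewrite /= in sA.
  (* Stability of A says that having a green partner in A is constant along edges of all three
     colours. *)
  have inv x y : connect (badj cols) x y -> (pi x \in A) = (pi y \in A).
    apply: (connect_invariant (k := fun x => pi x \in A)).
    suff H w v : badj cols (inl w) (inr v) -> (w \in A) = (((bgreen G)^-1)%g v \in A).
      by case=> w' [] v' //= E; [exact: H | apply/esym/H; rewrite badj_sym].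
    case/hasP=> r; rewrite !inE => /or3P[]/eqP-> /eqP<-.
    - by rewrite -permM (sA w).2.
    - by rewrite permK.
    - by rewrite -permM (sA w).1.
  have [->|[a aA]] := set_0Vmem A; first by rewrite eqxx.
  apply/orP; right; apply/eqP/setP=> w; rewrite inE.
  have /forallP/(_ (inl w)) := con (inl a).
  by move/inv; rewrite /= aA.
apply/forallP=> y.
apply: (connect_trans (connect_to_white x gc)).
rewrite connect_badjC; apply: (connect_trans (connect_to_white y gc)).
set x0 := to_white _ x; set y0 := to_white _ y.
(* The white vertices reachable from y0 form a nonempty stable set; by transitivity it contains
   x0. *)
pose A := [set w | connect (badj cols) (inl y0) (inl w)].
have /implyP := tr A; have -> : stable (gauge G) A.
  apply/stableP=> w; rewrite !inE /=; split.
    by rewrite ![connect _ (inl y0) _]connect_badjC; apply/esym/same_connect;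
       [exact: connect_badjC|exact: connect_badj_step].
  by rewrite ![connect _ (inl y0) _]connect_badjC; apply/esym/same_connect;
       [exact: connect_badjC|exact: connect_badj_step].
move=> /(_ isT)/orP[]/eqP/setP.
  by move/(_ y0); rewrite !inE connect0.
by move/(_ x0); rewrite !inE.
Qed.

Section Conj.
Variables (d : nat) (c : 'S_d).
Lemma cycles_of_length_conj (s : 'S_d) i :
  cycles_of_length (s ^ c)%g i = cycles_of_length s i.
Proof.
rewrite /cycles_of_length; set X := [set C in porbits s | #|C| == i].
rewrite -(card_imset X (imset_inj (@perm_inj _ c))); apply: eq_card => C.
have E x : porbit (s ^ c)%g (c x) = c @: porbit s x by apply: porbit_morph => y; rewrite permJ.
rewrite inE; apply/andP/imsetP => [[/imsetP[x _ ->] cx]|[D]].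
  exists (porbit s ((c^-1)%g x)); rewrite ?inE ?imset_f //=; last by rewrite -E permKV.
  by rewrite -{1}(permKV c x) E card_imset in cx; last exact: perm_inj.
rewrite inE => /andP[/imsetP[x _ ->] cx] ->; rewrite card_imset //; last exact: perm_inj.
by rewrite -E imset_f.
Qed.

Lemma card_porbits_conj (s : 'S_d) : #|porbits (s ^ c)%g| = #|porbits s|.
Proof.
rewrite -(card_imset (porbits s) (imset_inj (@perm_inj _ c))); apply: eq_card => C.
have E x : porbit (s ^ c)%g (c x) = c @: porbit s x by apply: porbit_morph => y; rewrite permJ.
apply/imsetP/imsetP => [[x _ ->]|[_ /imsetP[x _ ->] ->]].
  by exists (porbit s ((c^-1)%g x)); rewrite ?imset_f // -E permKV.
by exists (c x); rewrite ?E.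
Qed.

Lemma pair_has_type_conj (p : 'S_d * 'S_d) k l m :
  pair_has_type (p.1 ^ c, p.2 ^ c)%g k l m = pair_has_type p k l m.
Proof.
rewrite /pair_has_type /= !card_porbits_conj -conjVg -conjMg /cycle_type.
by under eq_map => i do rewrite cycles_of_length_conj.
Qed.

Lemma transitive_pair_conj (p : 'S_d * 'S_d) :
  transitive_pair p -> transitive_pair (p.1 ^ c, p.2 ^ c)%g.
Proof.
move=> /forallP tr; apply/forallP=> A; apply/implyP=> /stableP sA.
have /implyP := tr (c @^-1: A); have -> : stable p (c @^-1: A).
  by apply/stableP=> x; have [] := sA (c x); rewrite /= !permJ !inE => -> ->.
move=> /(_ isT)/orP[]/eqP/setP H; apply/orP; [left|right]; apply/eqP/setP=> x;
  by have := H ((c^-1)%g x); rewrite !inE permKV.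
Qed.
End Conj.

(** * The weighted number of Belyi graphs as a number of pairs *)

Section Count.
Variable d : nat.
Implicit Types (G : btriple d) (p : 'S_d * 'S_d).

Lemma relabel1 G : relabel 1%g G = G.
Proof. by case: G => -[b g] r; rewrite /relabel /bblue /bgreen /bred /= !invg1 !mul1g !mulg1. Qed.

Lemma relabelM G (p q : 'S_d * 'S_d) : relabel (p * q)%g G = relabel q (relabel p G).
Proof. by rewrite /relabel /bblue /bgreen /bred /= !invMg !mulgA. Qed.

Lemma gauge_relabel p G :
  gauge (relabel p G) = ((gauge G).1 ^ p.1, (gauge G).2 ^ p.1)%g.
Proof.
rewrite /gauge /relabel /bblue /bgreen /bred /= !invMg !invgK !conjgE.
by rewrite !mulgA !mulgK.
Qed.

Local Open Scope ring_scope.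

(** Orbit-stabilizer for the relabelling group, of order d!^2, gives a class C the weight |C| /
    d!^2. Each pair is the [gauge] of d! graphs, one for every green matching, which cancels one
    factor d!. *)
Lemma NcountE k l m :
  Ncount d k l m = #|[set p : 'S_d * 'S_d | transitive_pair p && pair_has_type p k l m]|%:R /
    (d`!)%:R.
Proof.
pose act := @TotalAction _ _ (fun G p => relabel p G) relabel1 relabelM.
have orbE G : [set relabel p G | p : 'S_d * 'S_d] = orbit act [set: 'S_d * 'S_d] G.
  by apply/setP=> H; apply/imsetP/imsetP => -[p _ ->]; exists p; rewrite ?inE.
pose X := [set G : btriple d | bconnected G && has_type G k l m].
pose Y := [set p : 'S_d * 'S_d | transitive_pair p && pair_has_type p k l m].
have XY G : (G \in X) = (gauge G \in Y) by rewrite !inE bconnected_gauge has_type_gauge.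
have X_act G p : G \in X -> relabel p G \in X.
  rewrite !XY !inE gauge_relabel => /andP[tr ty].
  by rewrite transitive_pair_conj // pair_has_type_conj.
have cX : #|X| = (d`! * #|Y|)%N.
  pose h (gp : 'S_d * ('S_d * 'S_d)) : btriple d := ((gp.2.2 * gp.1, gp.1), gp.2.1 * gp.1)%g.
  have hK gp : gauge (h gp) = gp.2 by case: gp => g [a b];
    rewrite /gauge /h /bblue /bgreen /bred /= !mulgK.
  have -> : X = h @: setX setT Y.
    apply/setP=> G; apply/idP/imsetP => [GX|[[g p]]].
      exists (bgreen G, gauge G); first by rewrite in_setX in_setT -XY.
      by case: (G) => -[b g] r; rewrite /h /gauge /bblue /bgreen /bred /= !mulgKV.
    by rewrite in_setX in_setT => pY ->; rewrite XY hK.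
  rewrite card_imset; first by rewrite cardsX cardsT card_Sn.
  move=> [g p] [g' p'] e; have := congr1 (@gauge d) e; rewrite !hK /= => <-.
  by have := congr1 (@bgreen d) e; rewrite /h /bgreen /= => ->.
have d0 : (d`!)%:R != 0 :> rat by rewrite pnatr_eq0 -lt0n fact_gt0.
have partX : X = cover (bclasses d k l m).
  apply/setP=> G; apply/idP/bigcupP => [GX|[_ /imsetP[H HX ->] /imsetP[p _ ->]]];
    last exact: X_act.
  by exists [set relabel p G | p : 'S_d * 'S_d]; [apply/imsetP; exists G|apply/imsetP;
    exists 1%g; rewrite ?relabel1].
have triv : trivIset (bclasses d k l m).
  apply/trivIsetP => _ _ /imsetP[G _ ->] /imsetP[H _ ->]; rewrite !orbE => ne.
  rewrite disjoints_subset; apply/subsetP=> K; rewrite inE => KG; apply: contra ne => KH.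
  by rewrite -(orbit_eqP KG) -(orbit_eqP KH).
have E C : C \in bclasses d k l m -> 1 / (#|bAut (brep C)|)%:R = #|C|%:R / ((d`!)%:R *
  (d`!)%:R) :> rat.
  case/imsetP=> G _ ->; rewrite orbE; set K := brep _.
  have KG : K \in orbit act setT G.
    rewrite /K /brep; case: pickP => [//|/(_ G)]; by rewrite orbit_refl.
  have := card_orbit_stab act [set: 'S_d * 'S_d]%G K.
  rewrite (orbit_eqP KG) cardsT card_prod card_Sn.
  have -> : 'C_[set: 'S_d * 'S_d]%G[K | act]%g = bAut K.
    by apply/setP=> p; rewrite [RHS]inE inE in_setT; apply/astab1P/eqP.
  move=> /(congr1 (fun n : nat => n%:R : rat)); rewrite !natrM => e.
  have c0 : #|bAut K|%:R != 0 :> rat.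
    by apply: contra_neq d0 => c0; move/eqP: e; rewrite c0 mulr0 eq_sym mulf_eq0 orbb => /eqP.
  rewrite -[X in _ = X / _](mulfK c0) e.
  by field; rewrite c0 d0.
rewrite /Ncount (eq_bigr _ E) -mulr_suml -natr_sum.
have -> : (\sum_(C in bclasses d k l m) #|C| = #|X|)%N by rewrite partX (eqP triv).
by rewrite cX natrM; field; rewrite d0.
Qed.
End Count.

(** * Comparison of power series with polynomials *)

Lemma nth_trim m i : nth 0 (trim m) i = nth 0 m i.
Proof.
elim: m i => [//|x m IHm] i /=; case: ifP => [/andP[/eqP-> /eqP e]|_];
  last by case: i => [|i] //=.
by rewrite nth_nil; case: i => [//|i] /=; rewrite -IHm e nth_nil.
Qed.

Lemma trim_ext a b : (forall i, nth 0 a i = nth 0 b i) -> trim a = trim b.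
Proof.
have nilE c : (forall i, nth 0 c i = 0) -> trim c = [::].
  by by elim: c => [//|x c IHc] H /=; rewrite (H 0 : x = 0) IHc // => i; have := H i.+1.
elim: a b => [|x a IHa] [|y b] H //; first by rewrite [RHS]nilE // => i; rewrite -H nth_nil.
  by rewrite [LHS]nilE // => i; rewrite H nth_nil.
have xy := H 0; rewrite /= in xy; rewrite /= xy (IHa b) // => i.
exact: (H i.+1).
Qed.

Lemma trimP a b : reflect (forall i, nth 0 a i = nth 0 b i) (trim a == trim b).
Proof.
apply: (iffP eqP) => [e i|]; last exact: trim_ext.
by rewrite -nth_trim e nth_trim.
Qed.

Lemma trim_id m : trim (trim m) = trim m.
Proof. by apply: trim_ext => i; rewrite nth_trim. Qed.

Lemma size_trim m : (size (trim m) <= size m)%N.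
Proof. by elim: m => [//|x m IHm] /=; case: ifP. Qed.

Lemma size_trim_le a b : (forall i, nth 0 a i <= nth 0 b i)%N -> (size (trim a) <= size (trim
  b))%N.
Proof.
elim: a b => [//|x a IHa] [|y b] H.
  suff -> : trim (x :: a) = [::] by [].
  by apply: (@trim_ext _ [::]) => i; apply/eqP; have := H i; rewrite nth_nil leqn0.
have := IHa b (fun i => H i.+1); have := H 0; rewrite /=.
case: (trim b) => [|z t]; last by rewrite andbF /=; case: ifP.
case: (trim a) => // /[swap] _; rewrite !andbT.
by case: x {H} => // x; case: y.
Qed.

Lemma coef_trim (G : PS) d k l m : coef G d k l (trim m) = coef G d k l m.
Proof. by rewrite /coef trim_id. Qed.

Lemma texp_trim m i : texp (trim m) i = texp m i.
Proof. exact: nth_trim. Qed.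

Lemma subvecs_cons x m :
  subvecs (x :: m) = [seq a :: s | a <- iota 0 x.+1, s <- subvecs m].
Proof. by []. Qed.

Lemma subvecsP x a :
  reflect (size a = size x /\ forall i, nth 0 a i <= nth 0 x i) (a \in subvecs x).
Proof.
elim: x a => [|x m IHm] a.
  rewrite inE; apply: (iffP eqP) => [->|[/size0nil->]] //.
rewrite subvecs_cons; apply: (iffP allpairsP) => [[[c s]] /= [cx /IHm[sz le] ->]|].
  split; first by rewrite /= sz.
  have {}cx : c \in iota 0 x.+1 := cx.
  by move: cx; rewrite mem_iota => /andP[_]; rewrite add0n ltnS => cx [|i] //=.
case: a => [|c s] [] //= [sz] le;
  have cx : c \in iota 0 x.+1 by rewrite mem_iota add0n ltnS (le 0).
have sm : s \in subvecs m by apply/IHm; split=> // i; apply: (le i.+1).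
by exists (c, s).
Qed.

Lemma subvecs_uniq x : uniq (subvecs x).
Proof.
elim: x => [//|x m IHm]; rewrite subvecs_cons; apply: allpairs_uniq; rewrite ?iota_uniq //.
by move=> [a s] [b t] _ _ /= [-> ->].
Qed.

Lemma size_vsub m a : size a = size m -> size (vsub m a) = size m.
Proof. by move=> e; rewrite size_map size_zip e minnn. Qed.

Lemma nth_vsub m a i : size a = size m -> nth 0 (vsub m a) i = nth 0 m i - nth 0 a i.
Proof.
by elim: m a i => [|x m IHm] [|y a] [|i] //= [e]; rewrite -?IHm.
Qed.

Section SubvecSums.
Local Open Scope ring_scope.

(** Needed because [coef] trims m before [ps_mul] lists its subvectors. A trailing exponent 0 leaves
    only the choice 0; phi is arbitrary so that the induction can absorb the head entries. *)
Lemma sum_subvecs_trim (R : nmodType) (phi : seq nat -> seq nat -> R) m :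
  \sum_(a <- subvecs (trim m)) phi (trim a) (trim (vsub (trim m) a))
  = \sum_(a <- subvecs m) phi (trim a) (trim (vsub m a)).
Proof.
elim: m phi => [//|x m IHm] phi.
pose tr y t := if (y == 0%N) && (t == [::]) then [::] else y :: t.
have E m' : \sum_(a <- subvecs (x :: m')) phi (trim a) (trim (vsub (x :: m') a))
  = \sum_(y <- iota 0 x.+1) \sum_(a <- subvecs m') phi (tr y (trim a)) (tr (x - y)%N (trim
    (vsub m' a))).
  by rewrite subvecs_cons big_allpairs_dep.
rewrite E; under [RHS]eq_bigr => y _ do rewrite -(IHm (fun t t' => phi (tr y t) (tr (x - y)%N
  t'))).
rewrite -E /=; case: ifP => // /andP[/eqP-> /eqP->].
by rewrite /= !big_cons !big_nil.
Qed.

Lemma coef_ps_mul (G H : PS) d k l m :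
  coef (ps_mul G H) d k l m = \sum_(d1 < d.+1) \sum_(k1 < k.+1) \sum_(l1 < l.+1) \sum_(a <-
    subvecs m)
       coef G d1 k1 l1 a * coef H (d - d1)%N (k - k1)%N (l - l1)%N (vsub m a).
Proof.
rewrite /coef {1}/ps_mul; apply: eq_bigr => d1 _; apply: eq_bigr => k1 _; apply: eq_bigr => l1 _.
exact: (sum_subvecs_trim (fun s t => G d1 k1 l1 s * H (d - d1)%N (k - k1)%N (l - l1)%N t)).
Qed.

Lemma mcoeffM_le n (R : nzRingType) (p q : {mpoly R[n]}) (e : 'X_{1..n}) :
  (p * q)@_e = \sum_(h : 'X_{1..n < (mdeg e).+1} | (bmnm h <= e)%MM) p@_h * q@_(e - h).
Proof. exact: (mcoeff_poly_mul_lin p q (ltnSn (mdeg e))). Qed.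

End SubvecSums.

Section Monomials.
Local Open Scope ring_scope.
Variable n : nat.
Definition mon (x : seq nat) : 'X_{1..n} := [multinom nth 0%N x i | i < n].

Lemma mon_val (h : 'X_{1..n}) : mon h = h.
Proof. by apply/mnmP=> i; rewrite mnmE -mnm_nth. Qed.

Lemma mcoeffM_subvecs (R : comNzRingType) (p q : {mpoly R[n]}) x : size x = n ->
  (p * q)@_(mon x) = \sum_(a <- subvecs x) p@_(mon a) * q@_(mon (vsub x a)).
Proof.
move=> sx; rewrite mcoeffM_le.
rewrite (perm_big [seq (h : seq nat) | h : 'X_{1..n < (mdeg (mon x)).+1} in [pred h | (bmnm h
  <= mon x)%MM]]) /=.
  rewrite big_map big_enum /=; apply: eq_bigr => h _; rewrite mon_val; congr (_ * _@__).
  by apply/mnmP=> i; rewrite mnmBE !mnmE nth_vsub ?size_tuple // -mnm_nth.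
apply: uniq_perm; first exact: subvecs_uniq.
  by rewrite map_inj_uniq ?enum_uniq // => h h' /val_inj/val_inj/val_inj.
move=> a; apply/subvecsP/mapP => [[sz le]|[h]].
  have leM : (mon a <= mon x)%MM by apply/mnm_lepP=> i; rewrite !mnmE.
  have bM : (mdeg (mon a) < (mdeg (mon x)).+1)%N.
    by rewrite ltnS !mdegE; apply: leq_sum => i _; rewrite !mnmE.
  exists (BMultinom bM); first by rewrite mem_enum.
  apply: (@eq_from_nth _ 0%N); first by rewrite size_tuple sz.
  move=> i; rewrite sz sx => lin; rewrite -[i]/(val (Ordinal lin)) -mnm_nth mnmE //.
rewrite mem_enum inE => /mnm_lepP le ->; rewrite size_tuple; split=> // i.
case: (ltnP i n) => lin; last by rewrite nth_default ?size_tuple.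
by have := le (Ordinal lin); rewrite !mnmE (mnm_nth 0%N).
Qed.
End Monomials.

Section Agree.
Local Open Scope ring_scope.
Variable N : nat.
Local Notation K := {mpoly rat[N.+3]}.

Definition mono d k l m : 'X_{1..N.+3} := mon N.+3 [:: d, k, l & m].

(* Agreement of coefficients for s-exponents up to D and t_1, ..., t_b only. The operators
   L_1, M_1, Q_1 differentiate by t_i up to i = 2b+1 in this range, so that N must be
   larger than b. *)
Definition agrees b D (p : K) (G : PS) :=
  forall d k l m, (d <= D)%N -> size m = N -> (size (trim m) <= b)%N ->
    p@_(mono d k l m) = coef G d k l m.

Lemma agreesW b D p G : agrees N D p G -> agrees b D p G.
Proof. by move=> pG d k l m dD sm _; apply: pG; rewrite // -[X in (_ <= X)%N]sm size_trim. Qed.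

(** A divisor of a monomial has no larger s-exponent and no further t variables, so both bounds are
    inherited. *)
Lemma agrees_mul b D p q G H : agrees b D p G -> agrees b D q H -> agrees b D (p * q) (ps_mul G
  H).
Proof.
move=> pG qH d k l m dD sm mb; rewrite coef_ps_mul mcoeffM_subvecs; last by rewrite /= sm.
have iotaE j (F : nat -> rat) : \sum_(i <- iota 0 j.+1) F i = \sum_(i < j.+1) F i.
  by rewrite -(big_mkord predT F) /index_iota subn0.
rewrite subvecs_cons big_allpairs_dep iotaE; apply: eq_bigr => d1 _.
rewrite subvecs_cons big_allpairs_dep iotaE; apply: eq_bigr => k1 _.
rewrite subvecs_cons big_allpairs_dep iotaE; apply: eq_bigr => l1 _.
rewrite big_seq [RHS]big_seq; apply: eq_bigr => a /subvecsP[sa le].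
have d1d : (d1 <= d)%N by rewrite -ltnS.
have sub_trim c : (forall i, nth 0%N c i <= nth 0%N m i)%N -> (size (trim c) <= b)%N.
  by move=> cm; apply: leq_trans mb; apply: size_trim_le.
rewrite -pG ?sa ?sub_trim //; last exact: leq_trans dD.
rewrite -qH ?size_vsub ?sub_trim // ?(leq_trans (leq_subr _ _)) // => i.
by rewrite nth_vsub // leq_subr.
Qed.

Lemma agrees_eq b D p G H : (forall d k l m, coef G d k l m = coef H d k l m) ->
  agrees b D p G -> agrees b D p H.
Proof. by move=> GH pG d k l m dD sm mb; rewrite -GH pG. Qed.

Lemma eq_mono d k l m d' k' l' m' : size m = N -> size m' = N ->
  (mono d k l m == mono d' k' l' m') = [&& d == d', k == k', l == l' & trim m == trim m'].
Proof.
move=> sm sm'; apply/eqP/and4P => [/mnmP e|[/eqP-> /eqP-> /eqP-> /trimP e]]; last first.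
  by apply/mnmP=> i; rewrite !mnmE; case: i => -[|[|[|i]]] /=.
have E i (lin : (i < N.+3)%N) : nth 0%N [:: d, k, l & m] i = nth 0%N [:: d', k', l' & m'] i.
  by have := e (Ordinal lin); rewrite !mnmE.
split; try apply/eqP; [exact: (E 0%N)|exact: (E 1%N)|exact: (E 2%N)|].
apply: trim_ext => i; case: (ltnP i N) => iN; first exact: (E i.+3).
by rewrite !nth_default ?sm ?sm'.
Qed.

Lemma agrees_one b D : agrees b D 1 ps_one.
Proof.
move=> d k l m dD sm mb; rewrite mcoeff1 /coef /ps_one trim_id.
have -> : 0%MM = mono 0 0 0 (nseq N 0%N).
  apply/mnmP=> i; rewrite !mnmE; case: i => -[|[|[|i]]] //= _; by rewrite nth_nseq if_same.
have -> : ([::] = trim (nseq N 0%N)) by apply: (@trim_ext [::]) => i;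
  rewrite nth_nseq nth_nil if_same.
by rewrite eq_mono ?size_nseq //; case: ifP.
Qed.

Lemma mcoeffXUM (i : 'I_N.+3) (p : K) e :
  ('X_i * p)@_e = if (0 < e i)%N then p@_(e - U_(i)) else 0.
Proof.
case: ifP => ei.
  have {1}-> : e = (U_(i) + (e - U_(i)))%MM.
    by rewrite addmC submK //; apply/mnm_lepP=> j; rewrite mnm1E; case: eqP => [<-|].
  by rewrite mulrC mcoeffMX.
rewrite mcoeffM_le big1 // => h /mnm_lepP le.
rewrite mcoeffX; case: eqP => [e'|]; last by rewrite mul0r.
by have := le i; rewrite -e' mnm1E eqxx ei.
Qed.

Lemma mono_incr d k l m j : (0 < j <= N)%N ->
  (mono d k l m + U_(tidx N j))%MM = mono d k l (incr_nth m j.-1).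
Proof.
case: j => [//|j] /= jN; apply/mnmP=> i; rewrite mnmDE mnm1E !mnmE -val_eqE /= tidxE //.
case: i => -[|[|[|i]]] //= _; rewrite ?addn0 //.
by rewrite nth_incr_nth addnC.
Qed.

Lemma size_incr_nth_lt m j : (0 < j <= N)%N -> size m = N -> size (incr_nth m j.-1) = N.
Proof. by move=> /andP[j0 jN] sm; rewrite size_incr_nth sm prednK // jN. Qed.

Lemma mono_t d k l m j : (0 < j <= N)%N -> mono d k l m (tidx N j) = texp m j.
Proof. by move=> /andP[j0 jN]; rewrite mnmE tidxE //; case: j j0 jN. Qed.

(** At the full bound N, because raising the exponent of t_j may lengthen the trimmed list beyond a
    smaller b. *)
Lemma agrees_dt D p G j : (0 < j <= N)%N -> agrees N D p G -> agrees N D p^`M(tidx N j) (ps_dt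
  j G).
Proof.
move=> jN pG d k l m dD sm mb; rewrite mcoeff_deriv mono_t // mono_incr //.
rewrite pG ?size_incr_nth_lt ?(leq_trans (size_trim _)) ?size_incr_nth_lt // /coef /ps_dt
  texp_trim mulr_natl; congr (G _ _ _ _ *+ _).
by apply: trim_ext => i; rewrite !nth_incr_nth nth_trim.
Qed.

Lemma agrees_ds b D p G : agrees b D.+1 p G -> agrees b D p^`M(sidx N) (ps_ds G).
Proof.
move=> pG d k l m dD sm mb; rewrite mcoeff_deriv.
have -> : (mono d k l m + U_(sidx N))%MM = mono d.+1 k l m.
  by apply/mnmP=> i; rewrite mnmDE mnm1E !mnmE -val_eqE /=; case: i => -[|[|[|i]]] //= _;
    rewrite ?addn0 ?addn1.
by rewrite pG // mnmE /= /coef /ps_ds /coef trim_id mulr_natl.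
Qed.

Lemma agrees_mult D p G i : (0 < i)%N -> agrees N D p G -> agrees N D (tvar N i * p) (ps_mult i
  G).
Proof.
move=> i0 pG d k l m dD sm mb; rewrite /tvar i0 /= [RHS]/coef /ps_mult texp_trim.
(* For i > N both sides vanish: [tvar] is 0, and a list of length N has exponent 0 at t_i. *)
case: (leqP i N) => iN; last first.
  by rewrite mul0r mcoeff0 /texp nth_default // sm; case: i i0 iN.
have iiN : (0 < i <= N)%N by rewrite i0.
rewrite mcoeffXUM mono_t //; case: ifP => // ti.
have -> : (mono d k l m - U_(tidx N i))%MM = mono d k l (set_nth 0%N m i.-1 (texp m i).-1).
  apply/mnmP=> j; rewrite mnmBE mnm1E !mnmE -val_eqE /= tidxE //.
  case: i i0 iN ti {iiN} => // i _ _ _.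
  case: j => -[|[|[|j]]] //= _; rewrite ?subn0 // nth_set_nth /=.
  by rewrite !eqSS eq_sym; case: eqP => [->|_]; rewrite ?subn0 ?subn1.
have sz : size (set_nth 0%N m i.-1 (texp m i).-1) = N.
  by rewrite size_set_nth sm; apply/maxn_idPr; rewrite prednK.
rewrite pG ?(leq_trans (size_trim _)) ?sz //.
rewrite /coef; congr (G _ _ _ _); apply: trim_ext => j.
by rewrite !nth_set_nth /= nth_trim.
Qed.

Lemma uidxE : uidx N = 1%N :> nat. Proof. by rewrite inordK. Qed.
Lemma vidxE : vidx N = 2%N :> nat. Proof. by rewrite inordK. Qed.

Lemma agrees_mulu b D p G : agrees b D p G -> agrees b D ('X_(uidx N) * p) (ps_mulu G).
Proof.
move=> pG d k l m dD sm mb; rewrite mcoeffXUM mnmE uidxE /= [RHS]/coef /ps_mulu.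
case: k => [//|k] /=; rewrite coef_trim -pG //; congr (_@__).
apply/mnmP=> i; rewrite mnmBE mnm1E !mnmE -val_eqE /= uidxE.
by case: i => -[|[|[|i]]] //= _; rewrite ?subn0 ?subn1.
Qed.

Lemma agrees_mulv b D p G : agrees b D p G -> agrees b D ('X_(vidx N) * p) (ps_mulv G).
Proof.
move=> pG d k l m dD sm mb; rewrite mcoeffXUM mnmE vidxE /= [RHS]/coef /ps_mulv.
case: l => [//|l] /=; rewrite coef_trim -pG //; congr (_@__).
apply/mnmP=> i; rewrite mnmBE mnm1E !mnmE -val_eqE /= vidxE.
by case: i => -[|[|[|i]]] //= _; rewrite ?subn0 ?subn1.
Qed.

Lemma coef_add G H d k l m : coef (ps_add G H) d k l m = coef G d k l m + coef H d k l m.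
Proof. by rewrite {1}/coef /ps_add !coef_trim. Qed.

Lemma agrees_add b D p q G H : agrees b D p G -> agrees b D q H -> agrees b D (p + q) (ps_add G
  H).
Proof. by move=> pG qH d k l m dD sm mb; rewrite mcoeffD coef_add pG ?qH. Qed.

End Agree.

(** * Differential equations modulo a power of s *)

Section SeriesAlgebra.
Variable N : nat.
Local Open Scope ring_scope.
Local Notation K := {mpoly rat[N.+3]}.
Local Notation s := ('X_(sidx N) : K).
Local Notation u := ('X_(uidx N) : K).
Local Notation v := ('X_(vidx N) : K).
Local Notation t := (tvar N).
Local Notation opL := (@opL N).
Local Notation opM := (@opM N).
Local Notation opQ := (@opQ N).

Definition spow_dvd k (p : K) := exists r, p = s ^+ k * r.

Lemma spow_dvd0 k : spow_dvd k 0. Proof. by exists 0; rewrite mulr0. Qed.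

Lemma spow_dvd_eq k p q : p = q -> spow_dvd k p -> spow_dvd k q.
Proof. by move=> ->. Qed.

Lemma spow_dvdD k p q : spow_dvd k p -> spow_dvd k q -> spow_dvd k (p + q).
Proof. by move=> [r ->] [r' ->]; exists (r + r'); rewrite mulrDr. Qed.

Lemma spow_dvd_mull k p q : spow_dvd k q -> spow_dvd k (p * q).
Proof. by move=> [r ->]; exists (p * r); rewrite mulrCA. Qed.

Lemma spow_dvdN k p : spow_dvd k p -> spow_dvd k (- p).
Proof. by move=> [r ->]; exists (- r); rewrite mulrN. Qed.

Lemma spow_dvdB k p q : spow_dvd k p -> spow_dvd k q -> spow_dvd k (p - q).
Proof. by move=> sp sq; apply: spow_dvdD => //; apply: spow_dvdN. Qed.

Lemma spow_dvd_sum k (I : eqType) (r : seq I) (P : pred I) (G : I -> K) :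
  (forall i, i \in r -> P i -> spow_dvd k (G i)) -> spow_dvd k (\sum_(i <- r | P i) G i).
Proof.
move=> H; rewrite big_seq_cond; elim/big_rec: _ => [|i p /andP[ir Pi] sp]; first exact: spow_dvd0.
by apply: spow_dvdD => //; apply: H.
Qed.

Lemma spow_dvdW k l p : (k <= l)%N -> spow_dvd l p -> spow_dvd k p.
Proof. by move=> kl [r ->]; exists (s ^+ (l - k) * r); rewrite mulrA -exprD subnKC. Qed.

Lemma mderiv_exp (p : K) i n : (p ^+ n.+1)^`M(i) = n.+1%:R * (p ^+ n * p^`M(i)).
Proof.
elim: n => [|n IHn]; first by rewrite expr1 expr0 !mul1r.
by rewrite exprS mderivM IHn -[n.+2%:R]natr1 exprS; ring.
Qed.

Lemma mderiv_s : s^`M(sidx N) = 1.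
Proof.
rewrite mderivX mnm1E eqxx scale1r.
have -> : (U_(sidx N) - U_(sidx N) = 0)%MM by apply/mnmP=> k; rewrite mnmBE mnm0E subnn.
exact: mpolyX0.
Qed.

Lemma mderiv_var (i j : 'I_N.+3) : i != j -> ('X_i : K)^`M(j) = 0.
Proof. by move=> ij; rewrite mderivX mnm1E (negbTE ij) scale0r. Qed.

(** For j up to N the index differs from that of s, so s^k is a constant for this derivative. *)
Lemma spow_dvd_dt k p j : (j <= N)%N -> spow_dvd k p -> spow_dvd k p^`M(tidx N j).
Proof.
move=> jN [r ->]; exists (r^`M(tidx N j)); rewrite mderivM.
have -> : (s ^+ k)^`M(tidx N j) = 0.
  case: k => [|k]; first by rewrite expr0 -mpolyC1 mderivC.
  by rewrite mderiv_exp mderiv_var ?mulr0 // -val_eqE /= tidxE.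
by rewrite mul0r add0r.
Qed.

Lemma spow_dvd_coef k p (e : 'X_{1..N.+3}) : spow_dvd k p -> (e (sidx N) < k)%N -> p@_e = 0.
Proof.
move=> [r ->]; elim: k e => [//|k IHk] e ek.
rewrite exprS -mulrA mcoeffXUM; case: ifP => // e0.
by apply: IHk; rewrite mnmBE mnm1E eqxx; move: ek e0; clear; lia.
Qed.

Lemma spow_dvd_opL k p : spow_dvd k p -> spow_dvd k (opL p).
Proof.
move=> sp; apply: spow_dvd_sum => i; rewrite mem_index_iota => /andP[i2 iN] _.
by do 2!apply: spow_dvd_mull; apply: spow_dvd_dt => //; move: i2 iN; clear; lia.
Qed.

Lemma spow_dvd_opM k p : spow_dvd k p -> spow_dvd k (opM p).
Proof.
move=> sp; apply: spow_dvd_sum => i; rewrite mem_index_iota => /andP[i2 iN] _.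
apply: spow_dvd_sum => j; rewrite mem_index_iota => /andP[j1 ji] _.
apply: spow_dvdD.
  by do 3!apply: spow_dvd_mull; apply: spow_dvd_dt => //; move: i2 iN; clear; lia.
by do 2!apply: spow_dvd_mull; do 2!(apply: spow_dvd_dt; [by move: i2 iN j1 ji; clear; lia|]).
Qed.

Definition opA (p : K) : K := (u + v) * opL p + opM p + u * v * t 1 * p.
Definition op_rhs (p : K) : K := (u + v) * opL p + opM p + opQ p + u * v * t 1.

Lemma spow_dvd_opA k p : spow_dvd k p -> spow_dvd k (opA p).
Proof.
move=> sp; apply: spow_dvdD; [apply: spow_dvdD|exact: spow_dvd_mull]; last exact: spow_dvd_opM.
by apply: spow_dvd_mull; apply: spow_dvd_opL.
Qed.

Lemma opAB : {morph opA : p q / p - q}.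
Proof.
have opLB : {morph opL : p q / p - q}.
  move=> p q; rewrite /opL -sumrB; apply: eq_bigr => i _; by rewrite mderivB !mulrBr.
have opMB : {morph opM : p q / p - q}.
  move=> p q; rewrite /opM -sumrB; apply: eq_bigr => i _; rewrite -sumrB.
  by apply: eq_bigr => j _; rewrite !mderivB; ring.
by move=> p q; rewrite /opA opLB opMB; ring.
Qed.

Lemma opA_const c p : (forall j, (0 < j <= N)%N -> c^`M(tidx N j) = 0) -> opA (c * p) = c * opA p.
Proof.
move=> c0; have D j q : (0 < j <= N)%N -> (c * q)^`M(tidx N j) = c * q^`M(tidx N j).
  by move=> jN; rewrite mderivM c0 // mul0r add0r.
rewrite /opA; have -> : opL (c * p) = c * opL p.
  rewrite /opL mulr_sumr; apply: eq_big_nat => i iN; rewrite D; last by move: iN; clear; lia.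
  by ring.
have -> : opM (c * p) = c * opM p.
  rewrite /opM mulr_sumr; apply: eq_big_nat => i iN; rewrite mulr_sumr; apply: eq_big_nat => j ji.
  rewrite !D; [|by move: iN ji; clear; lia..].
  by ring.
by ring.
Qed.

Section Exponential.
Variables (D : nat) (F g : K).
Hypothesis Fs : F = s * g.

Definition exp_trunc : K := \sum_(n < D.+1) (n`!%:R)^-1 *: F ^+ n.
Local Notation E := exp_trunc.

Lemma mderiv_exp_trunc i : E^`M(i) = F^`M(i) * (E - (D`!%:R)^-1 *: F ^+ D).
Proof.
rewrite /exp_trunc; elim: D => [|n IHn].
  by rewrite big_ord_recr big_ord0 /= add0r subrr mulr0 mderivZ expr0 -mpolyC1 mderivC scaler0.
rewrite big_ord_recr /= mderivD IHn addrK mderivZ mderiv_exp.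
have -> : (n.+1`!%:R^-1 : rat) *: (n.+1%:R * (F ^+ n * F^`M(i))) = n`!%:R^-1 *: (F ^+ n *
  F^`M(i)).
  by rewrite mulr_natl -scaler_nat scalerA factS natrM invfM mulrAC mulVf ?mul1r // pnatr_eq0.
by rewrite scalerAl; ring.
Qed.

(** Differentiating the partial sum loses exactly its last term F^D / D!, and s divides F. *)
Lemma spow_dvd_exp_trunc i : spow_dvd D (E^`M(i) - E * F^`M(i)).
Proof.
exists (- ((D`!%:R)^-1 *: (g ^+ D * F^`M(i)))).
have FD : F ^+ D = s ^+ D * g ^+ D by rewrite Fs exprMn.
by rewrite mderiv_exp_trunc FD -!mul_mpolyC; ring.
Qed.

Lemma exp_trunc_sub1 : spow_dvd 1 (E - 1).
Proof.
rewrite /exp_trunc big_ord_recl /= expr0 invr1 scale1r addrC addKr.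
apply: spow_dvd_sum => i _ _; rewrite -mul_mpolyC Fs exprMn; apply: spow_dvd_mull.
by exists (s ^+ i * g ^+ i.+1); rewrite expr1 mulrA -exprS.
Qed.

Lemma opA_exp_trunc : spow_dvd D (opA E - E * op_rhs F).
Proof.
have T (a b c d : K) : spow_dvd D (a - b) -> spow_dvd D (c * a - c * b).
  by rewrite -mulrBr; apply: spow_dvd_mull.
have HL : spow_dvd D (opL E - E * opL F).
  rewrite /opL mulr_sumr -sumrB; apply: spow_dvd_sum => i _ _.
  set c := _%:R; have -> : E * (c * (t i * F^`M(tidx N i.-1))) = c * (t i * (E * F^`M(tidx N
    i.-1))) by ring.
  by rewrite -!mulrBr; do 2!apply: spow_dvd_mull; apply: spow_dvd_exp_trunc.
have HM : spow_dvd D (opM E - E * (opM F + opQ F)).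
  rewrite /opM /opQ -big_split /= mulr_sumr -sumrB; apply: spow_dvd_sum => i.
  rewrite mem_index_iota => /andP[i2 iN] _.
  rewrite -big_split /= mulr_sumr -sumrB; apply: spow_dvd_sum => j.
  rewrite mem_index_iota => /andP[j1 ji] _.
  set a := i.-1%:R; set b := (j * (i - j))%:R.
  set E1 := E^`M(tidx N i.-1); set F1 := F^`M(tidx N i.-1).
  set Ej := E^`M(tidx N (i - j)); set Fj := F^`M(tidx N (i - j)).
  set Fk := F^`M(tidx N j).
  have e1 : spow_dvd D (E1 - E * F1) by apply: spow_dvd_exp_trunc.
  have ej : spow_dvd D (Ej - E * Fj) by apply: spow_dvd_exp_trunc.
  have ek : spow_dvd D (E^`M(tidx N j) - E * Fk) by apply: spow_dvd_exp_trunc.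
  have jN : (j <= N)%N by move: i2 iN j1 ji; clear; lia.
  (* The first-order congruence [ej] differentiated once more by a t variable; the product E_j
     F_(i-j) is the source of Q_1. *)
  have ejk : spow_dvd D (Ej^`M(tidx N j) - (E^`M(tidx N j) * Fj + E * Fj^`M(tidx N j))).
    by rewrite -mderivM -mderivB; apply: spow_dvd_dt.
  have := spow_dvdD (spow_dvd_mull (a * t j * t (i - j)) e1)
    (spow_dvdD (spow_dvd_mull (b * t i.+1) ejk) (spow_dvd_mull (b * t i.+1 * Fj) ek)).
  by apply: spow_dvd_eq; ring.
have := spow_dvdD (spow_dvd_mull (u + v) HL) HM; rewrite /opA /op_rhs.
by apply: spow_dvd_eq; ring.
Qed.

(* The linear equation Y' = Y k0 determines each coefficient in s from the previous ones. *)
Lemma ode_unique Y k0 : spow_dvd 1 Y -> spow_dvd D (Y^`M(sidx N) - Y * k0) -> spow_dvd D Y.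
Proof.
move=> Y1 [r Yr]; suff H k : (0 < k <= D)%N -> spow_dvd k Y.
  by case: (D) Yr H => [|D'] _ H; [exists Y; rewrite mul1r | apply: H; rewrite leqnn].
elim: k => [//|[|k] IHk] kD //.
have [|y Yy] := IHk; first by move: kD; clear; lia.
have s0 : s != 0 by rewrite -msize_poly_eq0 msizeX.
(* With Y = s^(k+1) y, cancelling s^k in the equation shows that s divides (k + 1) y, and k + 1 is
   invertible over [rat]. *)
have E1 : k.+1%:R * y = s * (s ^+ (D - k.+1) * r + y * k0 - y^`M(sidx N)).
  apply: (mulfI (expf_neq0 k s0)).
  have := Yr; rewrite Yy mderivM mderiv_exp mderiv_s => H.
  have -> : s ^+ k * (s * (s ^+ (D - k.+1) * r + y * k0 - y^`M(sidx N)))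
     = s ^+ D * r + s ^+ k.+1 * y * k0 - s ^+ k.+1 * y^`M(sidx N).
    have -> : s ^+ D = s ^+ k * s * s ^+ (D - k.+1).
      by rewrite -exprSr -exprD subnKC //; move: kD; clear; lia.
    by rewrite exprSr; ring.
  by rewrite -H; ring.
set w := (X in s * X) in E1.
have yE : y = s * ((k.+1%:R)^-1 *: w).
  by rewrite -scalerAr -E1 mulr_natl -scaler_nat scalerA mulVf ?scale1r // pnatr_eq0.
by exists ((k.+1%:R)^-1 *: w); rewrite Yy [in LHS]yE mulrA -exprSr.
Qed.

(** E is 1 modulo s, so X = E X - (E - 1) X gains one power of s at each step. *)
Lemma spow_dvd_cancel X : spow_dvd D (E * X) -> spow_dvd D X.
Proof.
move=> EX; have [e1 E1] := exp_trunc_sub1.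
suff H k : (k <= D)%N -> spow_dvd k X by apply: H.
elim: k => [|k IHk] kD; first by exists X; rewrite mul1r.
have -> : X = E * X - (E - 1) * X by ring.
apply: spow_dvdB; first exact: spow_dvdW EX.
have [x ->] := IHk (ltnW kD); rewrite E1 expr1; exists (e1 * x); rewrite exprS; ring.
Qed.

(** E and Z solve the same equation Y' = Y F' modulo s^D and are both 1 at s = 0, so they agree
    modulo s^D. This carries the linear equation from Z to E, and E can then be cancelled. *)
Theorem exp_trunc_odes Z : spow_dvd 1 (Z - 1) ->
  spow_dvd D (Z^`M(sidx N) - Z * F^`M(sidx N)) -> spow_dvd D (Z^`M(sidx N) - opA Z) ->
  spow_dvd D (F^`M(sidx N) - op_rhs F) /\ spow_dvd D (E^`M(sidx N) - opA E).
Proof.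
move=> Z1 ZF ZA.
have EZ : spow_dvd D (E - Z).
  apply: (@ode_unique _ F^`M(sidx N)).
    by have := spow_dvdB exp_trunc_sub1 Z1; apply: spow_dvd_eq; ring.
  rewrite mderivB; have := spow_dvdB (spow_dvd_exp_trunc (sidx N)) ZF.
  by apply: spow_dvd_eq; ring.
have EF := spow_dvd_exp_trunc (sidx N).
(* Differentiating E - Z by s would cost a power of s; instead E' is compared with E F', then Z F',
   Z', [opA Z] and [opA E]. *)
have EA : spow_dvd D (E^`M(sidx N) - opA E).
  have h1 := spow_dvd_mull F^`M(sidx N) EZ.
  have h2 := spow_dvd_opA EZ; rewrite opAB in h2.
  have := spow_dvdB (spow_dvdD (spow_dvdB EF ZF) (spow_dvdD ZA h1)) h2.
  by apply: spow_dvd_eq; ring.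
split=> //; apply: spow_dvd_cancel.
have := spow_dvdD (spow_dvdB EA EF) opA_exp_trunc.
by apply: spow_dvd_eq; ring.
Qed.

End Exponential.

End SeriesAlgebra.

(** * Generating series of pairs of permutations *)

Section CountingSeries.
Variable N : nat.
Local Open Scope ring_scope.
Local Notation K := {mpoly rat[N.+3]}.
Local Notation s := ('X_(sidx N) : K).
Local Notation u := ('X_(uidx N) : K).
Local Notation v := ('X_(vidx N) : K).
Local Notation t := (tvar N).
Local Notation W := (wsum u v t).
Local Notation Wc := (wsum_conn u v t).

Lemma mderiv_cycle_weight0 (f : nat -> K) (T : finType) (p : {perm T}) k :
  (forall i, (f i)^`M(k) = 0) -> (cycle_weight f p)^`M(k) = 0.
Proof.
move=> f0; rewrite /cycle_weight /blocks_weight mderiv_prod big1 // => C _.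
by rewrite f0 mul0r.
Qed.

Lemma mderivM0 (p q : K) k : p^`M(k) = 0 -> q^`M(k) = 0 -> (p * q)^`M(k) = 0.
Proof. by move=> p0 q0; rewrite mderivM p0 q0 mul0r mulr0 addr0. Qed.

Lemma mderiv_s_pair_weight (T : finType) (p : {perm T} * {perm T}) :
  (pair_weight u v t p)^`M(sidx N) = 0.
Proof.
do !apply: mderivM0; apply: mderiv_cycle_weight0 => i.
- by rewrite mderiv_var // -val_eqE /= uidxE.
- by rewrite mderiv_var // -val_eqE /= vidxE.
rewrite /tvar; case: ifP => [/andP[_ iN]|_]; last exact: mderiv0.
by rewrite mderiv_var // -val_eqE /= tidxE.
Qed.

Lemma opA_pair_weight n (p : 'S_n * 'S_n) : (n <= N)%N ->
  opA (pair_weight u v t p) = cycle_weight (fun=> u) p.1 * cycle_weight (fun=> v) p.2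
     * opA (cycle_weight t (p.1 * p.2^-1)%g).
Proof.
move=> nN; rewrite /pair_weight opA_const // => j /andP[j0 jN].
apply: mderivM0; apply: mderiv_cycle_weight0 => i.
  by rewrite mderiv_var // -val_eqE /= tidxE // uidxE.
by rewrite mderiv_var // -val_eqE /= tidxE // vidxE; case: j j0 {jN}.
Qed.

Lemma opA0 : opA (0 : K) = 0.
Proof. by have := opAB (0 : K) 0; rewrite !subrr. Qed.

Lemma opAD : {morph @opA N : p q / p + q}.
Proof.
move=> p q; have := opAB (p + q) q; rewrite addrK => ->.
by rewrite subrK.
Qed.

Lemma opA_sum (I : Type) (r : seq I) (P : pred I) (F : I -> K) :
  opA (\sum_(i <- r | P i) F i) = \sum_(i <- r | P i) opA (F i).
Proof. exact: (big_morph (@opA N) opAD opA0). Qed.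

(** The cycle sums of the insertion formula are recognised as [opL] and the two halves of [opM]; the
    weights in u and v are constants for these operators. *)
Lemma wsumS_opA n : (n <= N)%N -> W n.+1 = opA (W n).
Proof.
move=> nN; rewrite /wsum sum_pair_weightS opA_sum; apply: eq_bigr => p _.
rewrite opA_pair_weight // /opA opL_cycle_weight // opM_cycle_weight //=.
by congr (_ * _); ring.
Qed.

Lemma wsum0 : W 0 = 1.
Proof.
rewrite /wsum (eq_bigr (fun=> 1)) => [|p _].
  by rewrite sumr_const card_prod card_Sn.
have e (f : nat -> K) (q : 'S_0) : cycle_weight f q = 1.
  by apply: big1 => C /imsetP[[]].
by rewrite /pair_weight !e !mulr1.
Qed.

Lemma mderiv_s_wsum n : (W n)^`M(sidx N) = 0.
Proof. by rewrite raddf_sum big1 // => p _; apply: mderiv_s_pair_weight. Qed.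

Lemma mderiv_s_wsum_conn n : (Wc n)^`M(sidx N) = 0.
Proof. by rewrite raddf_sum big1 // => p _; apply: mderiv_s_pair_weight. Qed.

Variable D : nat.

Definition all_series : K := \sum_(n < D.+1) (n`!%:R)^-1 *: (s ^+ n * W n).
Definition conn_series : K := \sum_(n < D) (n.+1`!%:R)^-1 *: (s ^+ n.+1 * Wc n.+1).

Lemma mderiv_s_term n (w : K) : w^`M(sidx N) = 0 ->
  ((n.+1`!%:R)^-1 *: (s ^+ n.+1 * w))^`M(sidx N) = (n`!%:R)^-1 *: (s ^+ n * w).
Proof.
move=> w0; rewrite mderivZ mderivM w0 mulr0 addr0 mderiv_exp mderiv_s mulr1 -mulrA mulr_natl.
by rewrite -scaler_nat scalerA factS natrM invfM mulrAC mulVf ?mul1r // pnatr_eq0.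
Qed.

Lemma mderiv_all_series : all_series^`M(sidx N) = \sum_(n < D) (n`!%:R)^-1 *: (s ^+ n * W n.+1).
Proof.
rewrite /all_series big_ord_recl /= mderivD raddf_sum /= mderivZ expr0 mul1r mderiv_s_wsum
  scaler0 add0r.
by apply: eq_bigr => i _; rewrite /bump /= add1n mderiv_s_term // mderiv_s_wsum.
Qed.

Lemma mderiv_conn_series : conn_series^`M(sidx N) = \sum_(n < D) (n`!%:R)^-1 *: (s ^+ n * Wc
  n.+1).
Proof.
by rewrite /conn_series raddf_sum /=; apply: eq_bigr => i _;
  rewrite mderiv_s_term // mderiv_s_wsum_conn.
Qed.

Lemma conn_series_divs : conn_series = s * \sum_(n < D) (n.+1`!%:R)^-1 *: (s ^+ n * Wc n.+1).
Proof.
by rewrite mulr_sumr; apply: eq_bigr => n _; rewrite -scalerAr mulrA -exprS.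
Qed.

Lemma all_series_sub1 : spow_dvd 1%N (all_series - 1).
Proof.
rewrite /all_series big_ord_recl /= expr0 mul1r wsum0 invr1 scale1r addrC addKr.
apply: spow_dvd_sum => i _ _; exists ((i.+1`!%:R)^-1 *: (s ^+ i * W i.+1)).
by rewrite expr1 -scalerAr mulrA -exprS.
Qed.

(** The recursion cancels every term except the top one, which carries s^D. *)
Lemma all_series_opA : (D <= N)%N -> spow_dvd D (all_series^`M(sidx N) - opA all_series).
Proof.
move=> DN; rewrite mderiv_all_series /all_series big_ord_recr /= opAD opA_sum.
have sc n (w : K) : opA ((n`!%:R)^-1 *: (s ^+ n * w)) = (n`!%:R)^-1 *: (s ^+ n * opA w).
  rewrite -!mul_mpolyC mulrA opA_const -?mulrA // => j /andP[_ jN].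
  apply: mderivM0; first exact: mderivC.
  case: n => [|n]; first by rewrite expr0 -mpolyC1 mderivC.
  by rewrite mderiv_exp mderiv_var ?mulr0 // -val_eqE /= tidxE.
rewrite [X in _ - (X + _)](eq_bigr (fun n : 'I_D => (n`!%:R)^-1 *: (s ^+ n * W n.+1)));
  last first.
  by move=> i _; rewrite sc wsumS_opA // (leq_trans _ DN) // ltnW.
rewrite opprD addNKr sc; apply: spow_dvdN.
by exists ((D`!%:R)^-1 *: opA (W D)); rewrite -scalerAr.
Qed.

Lemma spow_dvd_horner (P : {poly K}) : (forall n, (n < D)%N -> P`_n = 0) -> spow_dvd D P.[s].
Proof.
move=> P0; rewrite horner_coef; apply: spow_dvd_sum => i _ _.
case: (ltnP i D) => iD; first by rewrite P0 // mul0r; apply: spow_dvd0.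
by apply: spow_dvd_mull; apply: spow_dvdW iD _; exists 1; rewrite mulr1.
Qed.

Lemma all_series_conn : spow_dvd D (all_series^`M(sidx N) - all_series * conn_series^`M(sidx N)).
Proof.
rewrite mderiv_all_series mderiv_conn_series /all_series.
(* The powers of s become formal in [{poly K}], where products are compared coefficient by
   coefficient; evaluation at s returns to K. *)
pose P n (E : nat -> K) := \poly_(i < n) ((i`!%:R)^-1 *: E i).
have PE n (E : nat -> K) : \sum_(i < n) (i`!%:R)^-1 *: (s ^+ i * E i) = (P n E).[s].
  by rewrite horner_poly; apply: eq_bigr => i _; rewrite mulrC scalerAl.
rewrite !(PE _ W) (PE _ (fun n => W n.+1)) (PE _ (fun n => Wc n.+1)) -hornerM -hornerN -hornerD.
apply: spow_dvd_horner => n nD; rewrite coefB coefMr coef_poly nD wsumS_conn.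
apply/eqP; rewrite subr_eq0; apply/eqP; rewrite scaler_sumr; apply: eq_bigr => e _.
have en : (e <= n)%N by rewrite -ltnS.
rewrite !coef_poly (leq_ltn_trans (leq_subr _ _) (leqW nD)) (leq_ltn_trans en nD).
rewrite -scalerAl -scalerAr scalerA mulr_natl -scaler_nat scalerA mulrC [Wc _ * _]mulrC.
have f0 k : (k`!%:R : rat) != 0 by rewrite pnatr_eq0 -lt0n fact_gt0.
congr (_ *: _); rewrite -(bin_fact en) !natrM.
have c0 : ('C(n, e)%:R : rat) != 0 by rewrite pnatr_eq0 -lt0n bin_gt0.
by field; rewrite !f0 c0.
Qed.

End CountingSeries.

(** * Agreement of the polynomial operators with those on power series *)

Section OperatorAgreement.
Variables (N b D : nat).
Hypothesis bN : (b.*2 + 2 <= N)%N.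
Local Open Scope ring_scope.
Local Notation K := {mpoly rat[N.+3]}.
Local Notation t := (tvar N).

Lemma mcoeff_tvarM0 d k l m i (p : K) : texp m i = 0%N -> (t i * p)@_(mono N d k l m) = 0.
Proof.
rewrite /tvar => ti; case: ifP => iN; last by rewrite mul0r mcoeff0.
by rewrite mcoeffXUM mono_t // ti.
Qed.

Lemma mcoeff_natM k (p : K) e : (k%:R * p)@_e = k%:R * p@_e.
Proof. by rewrite mulr_natl mcoeffMn mulr_natl. Qed.

Lemma texp_gt m i : (size (trim m) < i)%N -> texp m i = 0%N.
Proof. by move=> mi; rewrite -texp_trim /texp nth_default //; case: i mi. Qed.

(** Here [bnd] is at most 2b + 3, so [bN] puts it within N + 2; the derivatives occurring below it
    have index at most 2b + 1, hence at most N. *)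
Lemma sum_bnd (F : nat -> rat) m : (size (trim m) <= b)%N ->
  (forall i, (bnd (trim m) <= i)%N -> F i = 0) ->
  \sum_(2 <= i < N.+2) F i = \sum_(2 <= i < bnd (trim m)) F i.
Proof.
move=> mb F0; rewrite (@big_cat_nat _ _ _ (bnd (trim m))) /=; first last.
- by move: bN mb; rewrite /bnd -!mul2n; clear; lia.
- by rewrite /bnd addn3.
by rewrite [X in _ + X]big_nat_cond [X in _ + X]big1 ?addr0 // => i /andP[/andP[+ _] _];
  apply: F0.
Qed.

Lemma agrees_opL (p : K) G : agrees N D p G -> agrees b D (opL p) (L1 G).
Proof.
move=> pG d k l m dD sm mb; rewrite /opL raddf_sum /= {1}/coef /L1.
rewrite (@sum_bnd _ m mb) => [|i Bi].
  apply: eq_big_nat => i /andP[i2 iB]; rewrite mcoeff_natM coef_trim; congr (_ * _).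
  have iN : (0 < i.-1 <= N)%N by move: bN mb i2 iB; rewrite /bnd -!mul2n; clear; lia.
  apply: (agrees_mult (ltnW i2) (agrees_dt iN pG)) => //.
  by rewrite -[X in (_ <= X)%N]sm size_trim.
rewrite mcoeff_natM mcoeff_tvarM0 ?mulr0 // texp_gt //.
by move: Bi; rewrite /bnd -mul2n; clear; lia.
Qed.

Lemma agrees_opM (p : K) G : agrees N D p G -> agrees b D (opM p) (M1 G).
Proof.
move=> pG d k l m dD sm mb; rewrite /opM raddf_sum /= {1}/coef /M1.
have mN : (size (trim m) <= N)%N by rewrite -[X in (_ <= X)%N]sm size_trim.
rewrite (@sum_bnd _ m mb) => [|i Bi].
  apply: eq_big_nat => i /andP[i2 iB]; rewrite raddf_sum /=.
  apply: eq_big_nat => j /andP[j1 ji]; rewrite mcoeffD !mcoeff_natM !coef_trim.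
  have iN : (0 < i.-1 <= N)%N by move: bN mb i2 iB; rewrite /bnd -!mul2n; clear; lia.
  have jN : (0 < j <= N)%N by move: iN j1 ji; clear; lia.
  have ijN : (0 < i - j <= N)%N by move: iN j1 ji; clear; lia.
  have ij0 : (0 < i - j)%N by case/andP: ijN.
  congr (_ * _ + _ * _).
    exact: (agrees_mult j1 (agrees_mult ij0 (agrees_dt iN pG))).
  exact: (agrees_mult (ltn0Sn i) (agrees_dt jN (agrees_dt ijN pG))).
rewrite raddf_sum /= big_nat_cond big1 // => j /andP[/andP[j1 ji] _].
(* As j and i - j add up to more than twice the size of the trimmed list, one of t_j, t_(i-j) is
   absent from the monomial, and so is t_(i+1). *)
have {}Bi : (size (trim m) < j \/ size (trim m) < i - j)%N /\ (size (trim m) < i.+1)%N.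
  by move: Bi ji; rewrite /bnd -mul2n; clear; lia.
rewrite mcoeffD !mcoeff_natM [X in _ + _ * X]mcoeff_tvarM0 ?texp_gt ?Bi.2 // mulr0 addr0.
case: Bi => -[H|H] _; first by rewrite mcoeff_tvarM0 ?texp_gt ?mulr0.
by rewrite mulrCA mcoeff_tvarM0 ?texp_gt ?mulr0.
Qed.

Lemma agrees_opQ (p : K) G : agrees N D p G -> agrees b D (opQ p) (Q1 G).
Proof.
move=> pG d k l m dD sm mb; rewrite /opQ raddf_sum /= {1}/coef /Q1.
have mN : (size (trim m) <= N)%N by rewrite -[X in (_ <= X)%N]sm size_trim.
rewrite (@sum_bnd _ m mb) => [|i Bi].
  apply: eq_big_nat => i /andP[i2 iB]; rewrite raddf_sum /=.
  apply: eq_big_nat => j /andP[j1 ji]; rewrite !mcoeff_natM !coef_trim.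
  have jN : (0 < j <= N)%N by move: bN mb i2 iB j1 ji; rewrite /bnd -!mul2n; clear; lia.
  have ijN : (0 < i - j <= N)%N by move: bN mb i2 iB j1 ji; rewrite /bnd -!mul2n; clear; lia.
  congr (_ * _).
  exact: (agrees_mult (ltn0Sn i) (agrees_mul (agrees_dt jN pG) (agrees_dt ijN pG))).
rewrite raddf_sum /= big_nat_cond big1 // => j /andP[/andP[j1 ji] _].
rewrite mcoeff_natM mcoeff_tvarM0 ?mulr0 // texp_gt //.
by move: Bi; rewrite /bnd -mul2n; clear; lia.
Qed.

Lemma ps_uvt1E d k l m :
  coef (ps_mulu (ps_mulv (ps_mult 1 ps_one))) d k l m = coef ps_uvt1 d k l m.
Proof.
rewrite /coef /ps_uvt1 /ps_mulu /ps_mulv.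
case: k => [|k] /=; first by rewrite !andbF.
rewrite /coef trim_id; case: l => [|l] /=; first by rewrite !andbF.
rewrite /coef trim_id /ps_mult texp_trim /texp /= /coef /ps_one trim_id !eqSS.
case: m => [|x m] /=; first by rewrite !andbF.
case: x => [|x] /=; first by case: (trim m) => [|? ?] /=; rewrite !andbF.
rewrite eqseq_cons trim_id; case: (trim m) => [|y r] //=.
  by rewrite eqSS andbT; case: x.
by rewrite !andbF.
Qed.

Lemma agrees_uvt1 : agrees b D ('X_(uidx N) * 'X_(vidx N) * t 1 : K) ps_uvt1.
Proof.
apply: (agrees_eq ps_uvt1E); rewrite -mulrA -[t 1]mulr1.
apply/agrees_mulu/agrees_mulv/agreesW/agrees_mult => //; exact: agrees_one.
Qed.

Lemma agrees_op_rhs (p : K) G : agrees N D p G -> agrees b D (op_rhs p) (rhs G).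
Proof.
move=> pG; rewrite /op_rhs mulrDl -(addrA _ (opM p)); apply: agrees_add agrees_uvt1.
apply: agrees_add; last by apply: agrees_add; [apply: agrees_opM|apply: agrees_opQ].
by apply: agrees_add; [apply: agrees_mulu|apply: agrees_mulv]; apply: agrees_opL.
Qed.

Lemma agrees_opA (p : K) G : agrees N D p G -> agrees b D (opA p) (Aop G).
Proof.
move=> pG; rewrite /opA mulrDl -addrA; apply: agrees_add.
  by apply: agrees_add; [apply: agrees_mulu|apply: agrees_mulv]; apply: agrees_opL.
apply: agrees_add; first exact: agrees_opM.
by apply: agrees_mul agrees_uvt1 _; apply: agreesW.
Qed.

Lemma agrees_pow (p : K) G n : agrees b D p G -> agrees b D (p ^+ n) (ps_pow G n).
Proof.
by move=> pG; elim: n => [|n IHn]; [exact: agrees_one | rewrite exprS; exact: agrees_mul].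
Qed.

(** [ps_exp] stops at n = d and [exp_trunc] at n = D; the terms in between carry s^n with n > d and
    do not reach the coefficient of s^d. *)
Lemma agrees_exp_trunc (p g : K) G : p = 'X_(sidx N) * g -> agrees b D p G ->
  agrees b D (exp_trunc D p) (ps_exp G).
Proof.
move=> pg pG d k l m dD sm mb; rewrite /exp_trunc raddf_sum /= {1}/coef /ps_exp.
rewrite (big_ord_widen_cond D.+1 predT (fun n => coef (ps_pow G n) d k l (trim m) / n`!%:R)) //=.
rewrite [RHS]big_mkcond /=; apply: eq_bigr => n _; rewrite mcoeffZ mulrC coef_trim.
case: ifP => [nd|/negbT]; first by rewrite (agrees_pow _ pG).
rewrite -leqNgt => dn; rewrite (@spow_dvd_coef _ n) ?mul0r //.
  by exists (g ^+ n); rewrite pg exprMn.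
by rewrite mnmE.
Qed.

End OperatorAgreement.

(** * Cycle types, weights and the coefficients of F *)

Lemma weightE m M : size m <= M -> weight m = \sum_(i < M) i.+1 * nth 0 m i.
Proof.
move=> mM; rewrite /weight (big_ord_widen M (fun i => i.+1 * nth 0 m i) mM) big_mkcond /=.
by apply: eq_bigr => i _; case: ltnP => // ?; rewrite nth_default ?muln0.
Qed.

Lemma weight_trim m : weight (trim m) = weight m.
Proof.
rewrite (weightE (size_trim m)) (weightE (leqnn _)); apply: eq_bigr => i _.
by rewrite nth_trim.
Qed.

Section CycleType.
Variables (n : nat) (sigma : 'S_n).

Lemma cycle_length_bounds (C : {set 'I_n}) : C \in porbits sigma -> 0 < #|C| <= n.
Proof.
case/imsetP=> x _ ->; rewrite lt0n card_porbit_neq0 /=.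
by rewrite (leq_trans (max_card _)) // card_ord.
Qed.

Lemma cycles_of_lengthE i : cycles_of_length sigma i = \sum_(C in porbits sigma) (#|C| == i).
Proof.
rewrite /cycles_of_length -sum1_card big_mkcond [RHS]big_mkcond /=; apply: eq_bigr => C _.
by rewrite !inE; case: (C \in _).
Qed.

Lemma cycles_of_length_gt i : n < i -> cycles_of_length sigma i = 0.
Proof.
move=> ni; rewrite cycles_of_lengthE big1 // => C /cycle_length_bounds/andP[_ Cn].
by rewrite ltn_eqF // (leq_ltn_trans Cn).
Qed.

Definition padded_cycle_type N := [seq cycles_of_length sigma i | i <- iota 1 N].

Lemma nth_padded_cycle_type N i : n <= N -> nth 0 (padded_cycle_type N) i = cycles_of_length
  sigma i.+1.
Proof.
move=> nN; case: (ltnP i N) => iN; first by rewrite (nth_map 0) ?size_iota // nth_iota.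
by rewrite nth_default ?size_map ?size_iota // cycles_of_length_gt // ltnS (leq_trans nN).
Qed.

Lemma nth_cycle_type i : nth 0 (cycle_type sigma) i = cycles_of_length sigma i.+1.
Proof. exact: nth_padded_cycle_type. Qed.

Lemma trim_padded_cycle_type N : n <= N -> trim (padded_cycle_type N) = trim (cycle_type sigma).
Proof.
by move=> nN; apply: trim_ext => i; rewrite nth_cycle_type nth_padded_cycle_type.
Qed.

Lemma weight_cycle_type : weight (cycle_type sigma) = n.
Proof.
rewrite (@weightE _ n) ?size_map ?size_iota //.
transitivity (\sum_(C in porbits sigma) #|C|); last first.
  have := sum_porbits sigma (fun=> 1); rewrite sum1_card card_ord => e.
  apply: etrans (esym e); apply: eq_bigr => C _.
  by elim: #|C| => //= k IHk; rewrite mulrS -IHk.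
rewrite (eq_bigr (fun i : 'I_n => \sum_(C in porbits sigma) i.+1 * (#|C| == i.+1))); last first.
  move=> i _; rewrite -big_distrr -cycles_of_lengthE.
  congr (_ * _); exact: nth_cycle_type.
rewrite exchange_big /=; apply: eq_bigr => C /cycle_length_bounds/andP[C0 Cn].
have Cn' : #|C|.-1 < n by rewrite prednK.
rewrite (bigD1 (Ordinal Cn')) //= prednK // eqxx muln1 big1 ?addn0 // => i ne.
by case: eqP => [e|]; rewrite ?muln0 //; case/eqP: ne; apply: val_inj; rewrite /= e.
Qed.
End CycleType.

Section Agreement.
Variable N : nat.
Local Open Scope ring_scope.
Local Notation K := {mpoly rat[N.+3]}.
Local Notation s := ('X_(sidx N) : K).
Local Notation u := ('X_(uidx N) : K).
Local Notation v := ('X_(vidx N) : K).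
Local Notation t := (tvar N).

Lemma cycle_weight_monomial n (sigma : 'S_n) : (n <= N)%N ->
  cycle_weight t sigma = 'X_[mono N 0 0 0 (padded_cycle_type sigma N)].
Proof.
move=> nN; rewrite /cycle_weight /blocks_weight.
rewrite (eq_bigr (fun C : {set 'I_n} => 'X_[U_(tidx N #|C|)])) => [|C
  /cycle_length_bounds/andP[C0 Cn]].
  rewrite mprodXE; congr 'X_[_]; apply/mnmP=> i; rewrite mnm_sumE mnmE.
  have -> : (\sum_(C in porbits sigma) U_(tidx N #|C|)%MM i = \sum_(C in porbits sigma)
    (#|C|.+2 == i))%N.
    by apply: eq_bigr => C /cycle_length_bounds/andP[_ Cn];
      rewrite mnm1E -val_eqE /= tidxE // (leq_trans Cn).
  case: i => -[|[|[|i]]] /= _; try by rewrite big1 // => C /cycle_length_bounds; case: #|C|.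
  by rewrite nth_padded_cycle_type // cycles_of_lengthE.
by rewrite /tvar C0 (leq_trans Cn).
Qed.

Lemma pair_weight_monomial n d (p : 'S_n * 'S_n) : (n <= N)%N ->
  s ^+ d * pair_weight u v t p
    = 'X_[mono N d #|porbits p.1| #|porbits p.2| (padded_cycle_type (p.1 * p.2^-1)%g N)].
Proof.
move=> nN; rewrite /pair_weight cycle_weight_monomial //.
have E (w : K) (q : 'S_n) : cycle_weight (fun=> w) q = w ^+ #|porbits q| by rewrite
  /cycle_weight /blocks_weight prodr_const.
rewrite !E !mpolyXn -!mpolyXD; congr 'X_[_]; apply/mnmP=> i.
rewrite !(mnmDE, mulmnE, mnm1E, mnmE) -!val_eqE /= uidxE vidxE.
by case: i => -[|[|[|i]]] //= _; rewrite ?mul0n ?mul1n ?muln0 ?addn0 ?add0n.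
Qed.

(** The other conditions in [Fser] hold whenever some pair has the given type: a permutation of a
    nonempty set has a cycle, and a cycle type has weight d. Otherwise the count is 0. *)
Lemma coef_Fser d k l m : coef Fser d k l m =
  if (0 < d)%N then
    #|[set p : 'S_d * 'S_d | transitive_pair p && pair_has_type p k l m]|%:R / (d`!)%:R
  else 0.
Proof.
rewrite /coef /Fser; case: (posnP d) => [//|d0] /=.
have E : [set p : 'S_d * 'S_d | transitive_pair p && pair_has_type p k l (trim m)]
       = [set p : 'S_d * 'S_d | transitive_pair p && pair_has_type p k l m].
  by apply/setP=> p; rewrite !inE /pair_has_type trim_id.
rewrite NcountE E; case: ifP => // H; rewrite (_ : #|_| = 0%N) ?mul0r //.
apply/eqP; rewrite cards_eq0; apply/eqP/setP=> p; rewrite !inE; apply/negbTE/negP.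
case/andP=> _ /and3P[/eqP pk /eqP pl /eqP pm]; case/negP: H.
have x0 : 'I_d by exists 0%N.
rewrite -pk -pl.
have porbits_gt0 (q : 'S_d) : (0 < #|porbits q|)%N.
  by apply/card_gt0P; exists (porbit q x0); apply: imset_f.
by rewrite !porbits_gt0 weight_trim -weight_trim -pm weight_trim weight_cycle_type /=.
Qed.

Lemma agrees_conn_series b D : (D <= N)%N -> agrees b D (conn_series N D) Fser.
Proof.
move=> DN d k l m dD sm _; rewrite coef_Fser /conn_series raddf_sum /=.
have E n : (n <= N)%N -> (((n`!%:R)^-1 : rat) *: (s ^+ n * wsum_conn u v t n))@_(mono N d k l m)
    = if n == d then #|[set p : 'S_n * 'S_n | transitive_pair p && pair_has_type p k l m]|%:R /
      (n`!)%:R else 0.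
  move=> nN; rewrite mcoeffZ /wsum_conn mulr_sumr raddf_sum /=.
  rewrite (eq_bigr (fun p : 'S_n * 'S_n => ((n == d) && pair_has_type p k l m)%:R)); last first.
    move=> p _; have sz : size (padded_cycle_type (p.1 * p.2^-1)%g N) = N by rewrite size_map
      size_iota.
    rewrite (pair_weight_monomial _ _ nN) mcoeffX.
    by rewrite eq_mono // trim_padded_cycle_type.
  case: eqP => nd /=; last by rewrite big1 ?mulr0.
  rewrite mulrC; congr (_ / _); rewrite -sum1_card natr_sum big_mkcond [RHS]big_mkcond /=.
  by apply: eq_bigr => p _; rewrite inE; case: (transitive_pair p) => //=; case: pair_has_type.
rewrite (eq_bigr (fun n : 'I_D => if n.+1 == d then #|[set p : 'S_n.+1 * 'S_n.+1 |
  transitive_pair p && pair_has_type p k l m]|%:R / (n.+1`!)%:R else 0)); last first.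
  by move=> n _; rewrite E // (leq_trans _ DN).
case: d dD {E} => [|d] dD; first by rewrite big1.
rewrite (bigD1 (Ordinal dD)) //= eqxx big1 ?addr0 // => i ne.
by case: eqP => // -[e]; case/eqP: ne; apply: val_inj.
Qed.
End Agreement.

(** * Transfer of the equations to power series, and uniqueness *)

Section Equations.
Local Open Scope ring_scope.

Lemma Fser_odes d k l m :
  coef (ps_ds Fser) d k l m = coef (rhs Fser) d k l m /\
  coef (ps_ds (ps_exp Fser)) d k l m = coef (Aop (ps_exp Fser)) d k l m.
Proof.
(* N depends on the coefficient under study: 2b + 2 leaves room for the operators, and d + 1 is the
   order in s that the s-derivative reads at s^d. *)
pose b := size (trim m); pose N := (b.*2 + 2 + d.+1)%N.
have bN : (b.*2 + 2 <= N)%N by rewrite leq_addr.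
have dN : (d.+1 <= N)%N by rewrite leq_addl.
(* Trailing zeros do not change a coefficient, so m is replaced by a list of length N. *)
pose m' := trim m ++ nseq (N - b) 0%N.
have sm : size m' = N.
  by rewrite size_cat size_nseq subnKC //; move: bN; rewrite -mul2n; clear; lia.
have tm : trim m' = trim m.
  apply: trim_ext => i; rewrite nth_cat; case: ltnP => ib; first by rewrite nth_trim.
  by rewrite nth_nseq if_same -nth_trim nth_default.
have cm G : coef G d k l m = coef G d k l m' by rewrite /coef tm.
have mb : (size (trim m') <= b)%N by rewrite tm.
rewrite !cm; pose F := conn_series N d.+1.
have FF c : agrees c d.+1 F Fser by apply: agrees_conn_series.
have Fs := conn_series_divs N d.+1.
have EE c : agrees c d.+1 (exp_trunc d.+1 F) (ps_exp Fser) by apply: (agrees_exp_trunc Fs).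
have [odeF odeE] := exp_trunc_odes Fs (all_series_sub1 N d.+1) (all_series_conn N d.+1)
  (all_series_opA dN).
have sd : (mono N d k l m' (sidx N) < d.+1)%N by rewrite mnmE.
split.
  rewrite -(agrees_ds (FF b)) // -(agrees_op_rhs bN (FF N)) //.
  by apply/eqP; rewrite -subr_eq0 -mcoeffB (spow_dvd_coef odeF).
rewrite -(agrees_ds (EE b)) // -(agrees_opA bN (EE N)) //.
by apply/eqP; rewrite -subr_eq0 -mcoeffB (spow_dvd_coef odeE).
Qed.

(** No operator involves s, and the product in Q_1 only distributes the exponent d over two factors.
    The left-hand side reads order d + 1, so the equation determines a solution recursively. *)
Lemma rhs_local (G H : PS) d :
  (forall e k l m, (e <= d)%N -> coef G e k l m = coef H e k l m) ->
  forall k l m, coef (rhs G) d k l m = coef (rhs H) d k l m.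
Proof.
move=> GH.
have Edt j e k l m : (e <= d)%N -> coef (ps_dt j G) e k l m = coef (ps_dt j H) e k l m.
  by move=> ed; rewrite /coef /ps_dt GH.
have Emul j j' k l m : coef (ps_mul (ps_dt j G) (ps_dt j' G)) d k l m
    = coef (ps_mul (ps_dt j H) (ps_dt j' H)) d k l m.
  rewrite !coef_ps_mul; do 3!apply: eq_bigr => ? _; apply: eq_bigr => a _.
  by rewrite !Edt ?leq_subr // -ltnS.
have EL k l m : coef (L1 G) d k l m = coef (L1 H) d k l m.
  rewrite /coef /L1; apply: eq_bigr => i _; congr (_ * _).
  by rewrite /coef /ps_mult; case: ifP => // _; apply: Edt.
have EM k l m : coef (M1 G) d k l m = coef (M1 H) d k l m.
  rewrite /coef /M1; apply: eq_bigr => i _; apply: eq_bigr => j _.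
  congr (_ * _ + _ * _); rewrite /coef /ps_mult; case: ifP => // _; rewrite /coef.
    by case: ifP => // _; apply: Edt.
  by rewrite /ps_dt; congr (_ * _); apply: Edt.
have EQ k l m : coef (Q1 G) d k l m = coef (Q1 H) d k l m.
  rewrite /coef /Q1; apply: eq_bigr => i _; apply: eq_bigr => j _; congr (_ * _).
  by rewrite /coef /ps_mult; case: ifP => // _; apply: Emul.
move=> k l m; rewrite /rhs !coef_add EM EQ; congr (_ + _ + _ + _).
  by rewrite /coef /ps_mulu; case: k => // k; apply: EL.
by rewrite /coef /ps_mulv; case: l => // l; apply: EL.
Qed.

(** [Aop] is linear and free of s, so it acts on each order in s separately. Two orders are compared
    because the iterates of [Aop] on 1 live at order 0, while the coefficients of e^F run through
    all orders. *)
Lemma Aop_local (G H : PS) c d e :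
  (forall k l m, coef G d k l m = c * coef H e k l m) ->
  forall k l m, coef (Aop G) d k l m = c * coef (Aop H) e k l m.
Proof.
move=> GH.
have Edt j k l m : coef (ps_dt j G) d k l m = c * coef (ps_dt j H) e k l m.
  by rewrite /coef /ps_dt GH mulrCA.
have Emult i (G' H' : PS) k l m :
    (forall k l m, coef G' d k l m = c * coef H' e k l m) ->
    coef (ps_mult i G') d k l m = c * coef (ps_mult i H') e k l m.
  by move=> GH'; rewrite /coef /ps_mult; case: ifP => _; rewrite ?mulr0 ?GH'.
have EL k l m : coef (L1 G) d k l m = c * coef (L1 H) e k l m.
  rewrite /coef /L1 mulr_sumr; apply: eq_bigr => i _.
  by rewrite (Emult _ _ (ps_dt i.-1 H)) // mulrCA.
have EM k l m : coef (M1 G) d k l m = c * coef (M1 H) e k l m.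
  rewrite /coef /M1 mulr_sumr; apply: eq_bigr => i _; rewrite mulr_sumr; apply: eq_bigr => j _.
  rewrite (Emult _ _ (ps_mult (i - j) (ps_dt i.-1 H))) => [|? ? ?]; last exact: Emult.
  rewrite (Emult _ _ (ps_dt j (ps_dt (i - j) H))) => [|? ? ?];
    last by rewrite /coef /ps_dt Edt mulrCA.
  by rewrite mulrDr !mulrA ![c * _]mulrC.
have Eu k l m : coef (ps_mul ps_uvt1 G) d k l m = c * coef (ps_mul ps_uvt1 H) e k l m.
  (* Only the s-exponent 0 of [ps_uvt1] contributes to the product. *)
  rewrite !coef_ps_mul big_ord_recl [in RHS]big_ord_recl /= !subn0.
  rewrite [X in _ + X]big1 ?[X in _ * (_ + X)]big1 ?addr0; first last.
  - by move=> i _; do 3!(apply: big1 => ? _); rewrite /coef /ps_uvt1 mul0r.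
  - by move=> i _; do 3!(apply: big1 => ? _); rewrite /coef /ps_uvt1 mul0r.
  rewrite mulr_sumr; apply: eq_bigr => k1 _; rewrite mulr_sumr; apply: eq_bigr => l1 _.
  by rewrite mulr_sumr; apply: eq_bigr => a _; rewrite GH mulrCA.
move=> k l m; rewrite /Aop !coef_add EM Eu !mulrDr; congr (_ + _ + _).
  by rewrite /coef /ps_mulu; case: k => [|k]; rewrite ?mulr0 ?EL.
by rewrite /coef /ps_mulv; case: l => [|l]; rewrite ?mulr0 ?EL.
Qed.

Lemma iter_Aop_gt0 n d k l m : (0 < d)%N -> coef (iter n Aop ps_one) d k l m = 0.
Proof.
move=> d0; elim: n k l m => [|n IHn] k l m; first by rewrite /= /coef /ps_one gtn_eqF.
(* With the scalar 0 the locality lemma says that vanishing at order d is preserved. *)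
rewrite iterS (@Aop_local _ (iter n Aop ps_one) 0 d d) ?mul0r // => k' l' m'.
by rewrite IHn mul0r.
Qed.

Lemma coef_expsA1 d k l m : coef expsA1 d k l m = coef (iter d Aop ps_one) 0 k l m / (d`!)%:R.
Proof.
rewrite {1}/coef /expsA1 big_ord_recr /= subnn coef_trim big1 ?add0r // => n _.
by rewrite iter_Aop_gt0 ?mul0r // subn_gt0.
Qed.

(** The linear equation read at s^d: d + 1 times the next coefficient is [Aop] applied to the
    current one. *)
Lemma ps_exp_Fser d k l m : coef (ps_exp Fser) d k l m = coef (iter d Aop ps_one) 0 k l m /
  (d`!)%:R.
Proof.
elim: d k l m => [|d IHd] k l m.
  by rewrite {1}/coef /ps_exp big_ord_recr big_ord0 /= add0r coef_trim.
have [_] := Fser_odes d k l m.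
rewrite (@Aop_local _ (iter d Aop ps_one) (d`!%:R)^-1 d 0) => [|k' l' m'];
  last by rewrite IHd mulrC.
rewrite {1}/coef /ps_ds coef_trim iterS => E.
have d0 : (d.+1%:R : rat) != 0 by rewrite pnatr_eq0.
have f0 : (d`!%:R : rat) != 0 by rewrite pnatr_eq0 -lt0n fact_gt0.
by apply: (mulfI d0); rewrite E factS natrM; field; rewrite nat1r d0 f0.
Qed.

End Equations.

Theorem theorem2 :
  (* F satisfies dF/ds = ((u+v)L_1 + M_1 + Q_1) F + u v t_1 *)
  (forall d k l m, coef (ps_ds Fser) d k l m = coef (rhs Fser) d k l m) /\
  (* F is the unique solution with F|_{s=0} = 0 *)
  (forall G : PS,
     (forall d k l m, coef (ps_ds G) d k l m = coef (rhs G) d k l m) ->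
     (forall k l m, coef G 0 k l m = 0%R) ->
     forall d k l m, coef G d k l m = coef Fser d k l m) /\
  (* Z = e^F = e^{s((u+v)L_1 + M_1 + u v t_1)} 1 *)
  (forall d k l m, coef (ps_exp Fser) d k l m = coef expsA1 d k l m).
Proof.
split; first by move=> d k l m; case: (Fser_odes d k l m).
split; last by move=> d k l m; rewrite ps_exp_Fser coef_expsA1.
move=> G Gode G0; suff H n d : d <= n -> forall k l m, coef G d k l m = coef Fser d k l m.
  by move=> d k l m; apply: (H d).
elim: n d => [|n IHn] d; first by rewrite leqn0 => /eqP-> k l m; rewrite G0.
rewrite leq_eqVlt ltnS => /orP[/eqP->|/IHn//] k l m.
have [E _] := Fser_odes n k l m.
rewrite -(rhs_local (G := G)) -?Gode in E; last by move=> e k' l' m' en; apply: IHn.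
have n0 : (n.+1%:R != 0 :> rat)%R by rewrite pnatr_eq0.
by apply: (mulfI n0); move: E; rewrite /coef /ps_ds !coef_trim.
Qed.
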